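(* Let $\alpha\in\mathbb{R}$. If $a\in\mathbb{Z}$ and $q\in\mathbb{N}$ are such that $$\bigg|\alpha-\frac aq\bigg|\le\frac1{q^2}\quad\text{with}\quad (a,q)=1,$$ then $$S_2(\alpha,X):=\sum_{p_1p_2\le X} e(\alpha p_1p_2)\ll \frac{X}{q^{1/6}}(\log X)^{7/3}+X^{16/17}(\log X)^{39/17}+X^{7/8}q^{1/8}(\log X)^{9/4},$$ where the sum is taken over primes $p_1$ and $p_2$.
   Context: $e(x)=\exp(2\pi i x)$. The sum runs over ordered pairs $(p_1,p_2)$ of primes with $p_1p_2\le X$. $f\ll g$ means $|f|\le Kg$ for some constant $K$. *)

(* Defs.v *)
From mathcomp Require Import all_boot all_order all_algebra.
From mathcomp Require Import complex.
From mathcomp Require Import all_classical all_reals all_analysis.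

Set Implicit Arguments.
Unset Strict Implicit.
Unset Printing Implicit Defensive.

Import Order.TTheory GRing.Theory Num.Theory.

Local Open Scope ring_scope.
Local Open Scope complex_scope.

(* The libraries have no exponential on R[i]; for real x, y this is
   exp(x + iy) = e^x (cos y + i sin y). *)
Definition cexp {R : realType} (z : R[i]) : R[i] :=
  (expR (complex.Re z))%:C * (cos (complex.Im z) +i* sin (complex.Im z)).

Definition e {R : realType} (x : R) : R[i] := cexp ((2 * pi)%:C * 'i * x%:C).

(* Two primes with p1 * p2 <= X are both at most X, so bounding each index by
   the integer part of X removes no term. *)
Definition S2 {R : realType} (alpha X : R) : R[i] :=
  \sum_(0 <= p1 < (Num.truncn X).+1 | prime p1)
    \sum_(0 <= p2 < (Num.truncn X).+1 | prime p2 && ((p1 * p2)%:R <= X))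
      e (alpha * (p1 * p2)%:R).

(* Main.v *)
Require Import Defs.
From mathcomp Require Import all_boot all_order all_algebra.
From mathcomp Require Import complex.
From mathcomp Require Import all_classical all_reals all_analysis.
From mathcomp Require Import zify ring lra.

(** Write [N] for the integer part of [X], [L = ln N], and let [U] be the
    integer part of [N ^ (1/6)]. If [q > N] the third term of the bound exceeds
    the trivial estimate [2 X ln X] ([S2_trivial]). If [q <= N] the proof shows
    ([prime_pairs_bound]) that

      [S2 = O (L ^ 4 * sqrt (N * (N / q + q + N / U)))],

    a saving of [q ^ (1/2)], [(N / q) ^ (1/2)] or [N ^ (1/12)] at the price of
    four logarithms. Taking a geometric mean with the trivial bound trades the
    first two savings for the weaker powers [q ^ (1/6)] and [(X / q) ^ (1/8)] of
    the theorem, and reduces the number of logarithms as well; the third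
    saving beats [X ^ (1/17)] by a power of [X], which absorbs all logarithms
    ([interpolate_q], [interpolate_qX], [interpolate_X]).

    For the main estimate the pairs [(p1, p2)] are split according to the size
    of their members. If both exceed [U], the sum is bilinear, and Cauchy's
    inequality followed by summation over the free variable gives the bound
    ([typeII_bound], [large_primes]). If [p1 <= U], the indicator function of
    the primes [p2] is replaced by [mangoldt c / ln c], which changes little
    ([prime_mangoldt_diff]), and Vaughan's identity ([vaughan]) decomposes the
    sum over [c] into linear sums, with a free variable in a long interval, and
    a bilinear sum with both variables larger than [V = U ^ 2]. Three points
    keep the number of logarithms and the exponents under control.

    - The weight [1 / ln] stays inside the sums: it is monotone, so it is
      removed by summation by parts where a geometric sum appears, even after
      Cauchy's inequality, where the product of two such weights depends on all
      variables at once.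

    - The prime [p1 = r] is not fixed. In the linear sums, and after Cauchy's
      inequality in the bilinear ones, it multiplies the frequency, so it can
      be merged with another variable into [j = r * d]; a given [j] arises from
      at most [2 L] primes ([sum_multiplicity], [prime_divisors_le]). So
      everything reduces to sums over the multiples of [alpha] itself.

    - In Cauchy's inequality the pair [(r, m)] has weight [r * m], which
      treats all ranges of [r * m] simultaneously and replaces a dyadic
      decomposition.

    What remains is the sum over [j <= J] of the minimum of [N / j] and the
    reciprocal of the distance from [alpha * j] to the nearest integer. It is
    [O (L * (N / q + J + q))], because the multiples of [alpha] are spaced by
    about [1 / q] over blocks of [q / 2] consecutive indices ([kern_sum]). *)

Set Implicit Arguments.
Unset Strict Implicit.
Unset Printing Implicit Defensive.

Import Order.TTheory GRing.Theory Num.Theory.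
Import ComplexField.Normc.

Local Open Scope ring_scope.
Local Open Scope complex_scope.

(** * The additive character *)

Section Exponential.
Variable R : realType.
Implicit Types (x y B : R) (z : R[i]).

Lemma norm_normc z : `|z| = (normc z)%:C.
Proof. by rewrite normc_def; case: z. Qed.

Lemma normc_ge0 z : 0 <= normc z.
Proof. by case: z => a b; apply: sqrtr_ge0. Qed.

Lemma normc_real x : normc (x%:C) = `|x|.
Proof. by rewrite /= expr0n /= addr0 sqrtr_sqr. Qed.

Lemma le_normc_sum (I : Type) (s : seq I) (P : pred I) (F : I -> R[i]) :
  normc (\sum_(i <- s | P i) F i) <= \sum_(i <- s | P i) normc (F i).
Proof.
elim/big_rec2: _ => [|i y1 y2 _ h]; first by rewrite normc0.
by apply: le_trans (le_normcD _ _) _; rewrite lerD2l.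
Qed.

Lemma conjcM z z' : conjc (z * z') = conjc z * conjc z'.
Proof. exact: rmorphM. Qed.

Lemma conjc_sum (I : Type) (s : seq I) (P : pred I) (F : I -> R[i]) :
  conjc (\sum_(i <- s | P i) F i) = \sum_(i <- s | P i) conjc (F i).
Proof. exact: rmorph_sum. Qed.

Lemma normc_sqr z : (normc z ^+ 2)%:C = z * conjc z.
Proof. by rewrite rmorphXn /= -norm_normc sqr_normc. Qed.

Lemma eE x : e x = cos (2 * pi * x) +i* sin (2 * pi * x).
Proof.
rewrite /e /cexp; have -> : (2 * pi)%:C * 'i * x%:C = 0 +i* (2 * pi * x) :> R[i].
  by simpc.
by rewrite /= expR0 mul1r.
Qed.

Lemma eD x y : e (x + y) = e x * e y :> R[i].
Proof.
rewrite !eE mulrDr cosD sinD; simpc; congr (_ +i* _).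
by rewrite addrC [cos _ * sin _]mulrC.
Qed.

Lemma e0 : e 0 = 1 :> R[i].
Proof. by rewrite eE mulr0 cos0 sin0. Qed.

Lemma e1 : e 1 = 1 :> R[i].
Proof. by rewrite eE mulr1 mulr_natl cos2pi sin2pi. Qed.

Lemma normc_e x : normc (e x) = 1 :> R.
Proof. by rewrite eE /= cos2Dsin2 sqrtr1. Qed.

Lemma eN x : e (- x) = conjc (e x) :> R[i].
Proof. by rewrite !eE mulrN cosN sinN. Qed.

Lemma e_natmul x n : e (n%:R * x) = e x ^+ n :> R[i].
Proof.
elim: n => [|n IH]; first by rewrite mul0r e0 expr0.
by rewrite -addn1 natrD mulrDl mul1r eD IH addn1 exprSr.
Qed.

Lemma e_int (k : int) : e k%:~R = 1 :> R[i].
Proof.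
have h n : e n%:R = 1 :> R[i] by rewrite -[n%:R]mulr1 e_natmul e1 expr1n.
by case: k => n; rewrite ?NegzE ?mulrNz ?eN h // conjc1.
Qed.

(** * The chordal distance to the nearest integer *)

(** [chord x] is [2 * `|sin (pi * x)|]; it stands for the distance from [x] to
    the nearest integer, to which it is comparable, but it is subadditive and
    interacts with geometric sums without case distinctions. *)
Definition chord x : R := normc (1 - e x).

Lemma chord_ge0 x : 0 <= chord x. Proof. exact: normc_ge0. Qed.

Lemma chordN x : chord (- x) = chord x.
Proof.
rewrite /chord eN -[LHS]ger0_norm ?normc_ge0 //.
apply: complexI; rewrite ger0_norm ?normc_ge0 // -!norm_normc.
by rewrite -{1}conjc1 -rmorphB normcJ.
Qed.

Lemma chordDint x (k : int) : chord (x + k%:~R) = chord x.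
Proof. by rewrite /chord eD e_int mulr1. Qed.

Lemma chord_double x : chord (2 * x) <= 2 * chord x.
Proof.
rewrite /chord e_natmul.
have -> : 1 - e x ^+ 2 = (1 + e x) * (1 - e x) :> R[i] by ring.
rewrite normcM ler_wpM2r ?normc_ge0 // (le_trans (le_normcD _ _)) //.
by rewrite normc_e normc1.
Qed.

Lemma Re_le_normc z : complex.Re z <= normc z.
Proof.
rewrite -lecR -norm_normc.
apply: le_trans (normc_ge_Re z); rewrite lecR; exact: ler_norm.
Qed.

Lemma chord_ge1 x : 1 / 4 <= x <= 1 / 2 -> 1 <= chord x.
Proof.
move=> /andP[x1 x2]; apply: le_trans (Re_le_normc _).
rewrite eE /= lerDl oppr_ge0 -[2 * pi * x](subrK (pi : R)) cosDpi oppr_le0.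
have pi0 := pi_gt0 R.
by apply: cos_ge0_pihalf; apply/andP; split; nra.
Qed.

(** Doubling at most doubles the chord, and doubling often enough brings any
    point of [(0, 1/2]] into [[1/4, 1/2]], where the chord is at least [1]. *)
Lemma chord_ge_half x : 0 <= x <= 1 / 2 -> x <= chord x.
Proof.
move=> /andP[x0 x2].
suff H n : forall y, 0 <= y <= 1 / 2 -> 1 / 4 <= 2 ^+ n * y -> y <= chord y.
  move: x0; rewrite le_eqVlt => /predU1P[<-|x0]; first exact: chord_ge0.
  have [n hn] : exists n : nat, 1 / 4 <= 2 ^+ n * x.
    exists (Num.truncn (x^-1)).+1.
    have h1 : x^-1 < (Num.truncn (x^-1)).+1%:R by apply: truncnS_gt.
    have h2 : (Num.truncn (x^-1)).+1%:R <= 2 ^+ (Num.truncn (x^-1)).+1 :> R.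
      by rewrite -natrX ler_nat ltnW // ltn_expl.
    have h3 : x^-1 * x = 1 by rewrite mulVf // gt_eqF.
    have : x^-1 * x <= 2 ^+ (Num.truncn (x^-1)).+1 * x.
      by rewrite ler_wpM2r ?(ltW x0) //; apply: le_trans (ltW h1) h2.
    by rewrite h3; lra.
  by apply: (H n) => //; rewrite ltW.
elim: n => [|n IH] y /andP[y0 y2] hy.
  rewrite expr0 mul1r in hy.
  by apply: (@le_trans _ _ 1); [|apply: chord_ge1; apply/andP]; lra.
have [y4|y4] := lerP (1 / 4) y.
  by apply: (@le_trans _ _ 1); [|apply: chord_ge1; apply/andP]; lra.
have := chord_double y.
have : 2 * y <= chord (2 * y).
  by apply: IH; [apply/andP; split; lra | rewrite mulrA -exprSr].
by lra.
Qed.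

Definition fpart x := x - (Num.floor x)%:~R.

Lemma fpart_ge0 x : 0 <= fpart x.
Proof. by rewrite subr_ge0 ge_floor. Qed.

Lemma fpart_lt1 x : fpart x < 1.
Proof. by rewrite ltrBlDl; have := floorD1_gt x; rewrite intrD. Qed.

(** At this scale the constants are irrelevant, and [chord] may be replaced by
    the distance to the nearest integer, read off from the fractional part. *)
Lemma chord_fpart x : Num.min (fpart x) (1 - fpart x) <= chord x.
Proof.
have -> : chord x = chord (fpart x) by rewrite /fpart -mulrNz chordDint.
have := fpart_ge0 x; have := fpart_lt1 x; set y := fpart x => y1 y0.
rewrite ge_min; have [h|h] := lerP y (1 / 2).
  by rewrite chord_ge_half //; apply/andP.
have -> : chord y = chord (1 - y) by rewrite -chordN -(chordDint _ 1) addrC.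
by rewrite chord_ge_half ?orbT //; apply/andP; split; lra.
Qed.

(** * Linear exponential sums with monotone weights *)

(** Up to a factor [2] this is [min B (1 / chord x)], without division by a
    possibly vanishing chord. *)
Definition kern B x := B / (1 + B * chord x).

Lemma kern_den B x : 0 <= B -> 0 < 1 + B * chord x.
Proof. by move=> B0; rewrite ltr_wpDr // mulr_ge0 // chord_ge0. Qed.

Lemma kern_ge0 B x : 0 <= B -> 0 <= kern B x.
Proof. by move=> B0; rewrite divr_ge0 // ltW // kern_den. Qed.

Lemma kern_le B x : 0 <= B -> kern B x <= B.
Proof.
move=> B0; rewrite ler_pdivrMr ?kern_den // mulrDr mulr1 lerDl.
by rewrite !mulr_ge0 ?chord_ge0.
Qed.

Lemma kern_chord B x c : 0 <= B -> 0 < c -> c <= chord x -> kern B x <= c^-1.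
Proof.
move=> B0 c0 h; rewrite ler_pdivrMr ?kern_den // mulrDr mulr1.
rewrite mulrCA; have h1 : 0 <= c^-1 by rewrite invr_ge0 ltW.
have h2 : B <= B * (c^-1 * chord x).
  by rewrite ler_peMr // mulrC ler_pdivlMr // mul1r.
by rewrite (le_trans h2) // lerDr.
Qed.

Lemma kern_mono B B' x : 0 <= B -> B <= B' -> kern B x <= kern B' x.
Proof.
move=> B0 hB; have B'0 := le_trans B0 hB; have D0 := chord_ge0 x.
rewrite ler_pdivrMr ?kern_den // mulrAC ler_pdivlMr ?kern_den //.
by nra.
Qed.

Lemma kernN B x : kern B (- x) = kern B x.
Proof. by rewrite /kern chordN. Qed.

(** The sum is at most its length and, by telescoping, at most [2 / chord x];
    [kern] combines both. *)
Lemma geometric_kern s t x B : (t - s)%:R <= B ->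
  normc (\sum_(s <= m < t) e (m%:R * x)) <= 3 * kern B x.
Proof.
move=> hB; have B0 : 0 <= B by apply: le_trans hB.
set S := \sum_(_ <= _ < _) _.
have S1 : normc S <= B.
  apply: le_trans (le_normc_sum _ _ _) _; apply: le_trans hB.
  rewrite (eq_bigr (fun=> 1)) => [|i _]; last exact: normc_e.
  by rewrite sumr_const_nat.
have S2 : chord x * normc S <= 2.
  rewrite /chord -normcM /S.
  have -> : (1 - e x) * \sum_(s <= m < t) e (m%:R * x) =
            \sum_(s <= m < t) (e (m%:R * x) - e (m.+1%:R * x)) :> R[i].
    rewrite mulr_sumr; apply: eq_bigr => i _.
    by rewrite mulrBl mul1r -eD -natr1 mulrDl mul1r [x + _]addrC.
  have [ts|st] := leqP t s; first by rewrite big_geq // normc0.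
  have -> : \sum_(s <= m < t) (e (m%:R * x) - e (m.+1%:R * x)) =
      - (e (t%:R * x) - e (s%:R * x)) :> R[i].
    rewrite -(telescope_sumr (fun m => e (m%:R * x)) (ltnW st)) -sumrN.
    by apply: eq_bigr => i _; rewrite opprB.
  by rewrite normcN (le_trans (le_normcD _ _)) // normcN !normc_e.
have N0 := normc_ge0 S; have D0 := chord_ge0 x.
rewrite mulrA ler_pdivlMr ?kern_den //.
have : B * (chord x * normc S) <= B * 2 by rewrite ler_wpM2l.
by lra.
Qed.

(** Summation by parts: the weights [w m - w m.+1] put on the partial sums are
    nonnegative and telescope to at most [w s]. *)
Lemma abel_decr (w : nat -> R) (z : nat -> R[i]) s t W B : 0 <= B ->
  (forall m, (s <= m < t)%N -> 0 <= w m) ->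
  (forall m, (s <= m)%N -> (m.+1 < t)%N -> w m.+1 <= w m) ->
  ((s < t)%N -> w s <= W) -> 0 <= W ->
  (forall t', (t' <= t)%N -> normc (\sum_(s <= m < t') z m) <= B) ->
  normc (\sum_(s <= m < t) (w m)%:C * z m) <= W * B.
Proof.
move=> B0 w0 wd wW W0 hz.
have [ts|st] := leqP t s; first by rewrite big_geq // normc0 mulr_ge0.
pose T n := \sum_(s <= m < n) z m.
(* Subtracting [w n * T n] is what makes the differences telescope. *)
have key n : (s <= n)%N -> (n < t)%N ->
    normc (\sum_(s <= m < n) (w m)%:C * z m - (w n)%:C * T n) <= (w s - w n) * B.
  elim: n => [|n IH] sn nt.
    by move: sn; rewrite leqn0 => /eqP ->; rewrite /T !big_geq // mulr0 subr0 normc0 subrr mul0r.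
  move: sn; rewrite leq_eqVlt => /predU1P[<-|sn].
    by rewrite /T !big_geq // mulr0 subr0 normc0 subrr mul0r.
  have {}IH := IH sn (ltnW nt).
  rewrite big_nat_recr //=.
  have -> : \sum_(s <= i < n) (w i)%:C * z i + (w n)%:C * z n - (w n.+1)%:C * T n.+1
     = (\sum_(s <= i < n) (w i)%:C * z i - (w n)%:C * T n) + (w n - w n.+1)%:C * T n.+1.
    by rewrite /T [in LHS]big_nat_recr //= [in RHS]big_nat_recr //= rmorphB /=; ring.
  apply: le_trans (le_normcD _ _) _; rewrite normcM normc_real.
  have h1 := wd n sn nt; rewrite ger0_norm ?subr_ge0 //.
  have h2 : (w n - w n.+1) * normc (T n.+1) <= (w n - w n.+1) * B.
    by rewrite ler_wpM2l ?subr_ge0 // hz // ltnW.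
  by lra.
case: t => // t in hz w0 wd wW st key *.
have := key t st (ltnSn t); rewrite big_nat_recr //= => h.
have -> : \sum_(s <= i < t) (w i)%:C * z i + (w t)%:C * z t =
   (\sum_(s <= i < t) (w i)%:C * z i - (w t)%:C * T t) + (w t)%:C * T t.+1.
  by rewrite /T [in RHS]big_nat_recr //=; ring.
apply: le_trans (le_normcD _ _) _; rewrite normcM normc_real.
have wt : 0 <= w t by apply: w0; rewrite -ltnS st ltnSn.
rewrite ger0_norm //.
have h2 : w t * normc (T t.+1) <= w t * B by rewrite ler_wpM2l // hz.
have h3 : w s * B <= W * B by rewrite ler_wpM2r // wW.
by lra.
Qed.

(** The weight [W - w] is decreasing, at the cost of one unweighted sum. *)
Lemma abel_incr (w : nat -> R) (z : nat -> R[i]) s t W B : 0 <= B ->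
  (forall m, (s <= m < t)%N -> 0 <= w m <= W) ->
  (forall m, (s <= m)%N -> (m.+1 < t)%N -> w m <= w m.+1) ->
  0 <= W ->
  (forall t', (t' <= t)%N -> normc (\sum_(s <= m < t') z m) <= B) ->
  normc (\sum_(s <= m < t) (w m)%:C * z m) <= 2 * W * B.
Proof.
move=> B0 w0 wd W0 hz.
have -> : \sum_(s <= m < t) (w m)%:C * z m =
  W%:C * \sum_(s <= m < t) z m - \sum_(s <= m < t) (W - w m)%:C * z m.
  rewrite mulr_sumr -sumrB; apply: eq_bigr => m _.
  by rewrite rmorphB /=; ring.
apply: le_trans (le_normcD _ _) _; rewrite normcN normcM normc_real ger0_norm //.
have h1 : W * normc (\sum_(s <= m < t) z m) <= W * B by rewrite ler_wpM2l // hz.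
have h2 : normc (\sum_(s <= m < t) (W - w m)%:C * z m) <= W * B.
  apply: abel_decr => // [m /w0/andP[]|m sm mt|st]; rewrite ?subr_ge0 //.
    by rewrite lerD2l lerN2 wd.
  have /andP[h _] : 0 <= w s <= W by apply: w0; rewrite leqnn.
  by rewrite lerBlDr lerDl.
by lra.
Qed.

End Exponential.

(** * Harmonic sums and logarithms *)

Section Harmonic.
Variable R : realType.

Definition harm (n : nat) : R := \sum_(1 <= k < n.+1) k%:R^-1.

Lemma harm_ge0 n : 0 <= harm n.
Proof. by apply: sumr_ge0 => i _; rewrite invr_ge0. Qed.

Lemma harm_mono m n : (m <= n)%N -> harm m <= harm n.
Proof.
move=> mn; rewrite /harm (@big_cat_nat _ _ _ m.+1 1 n.+1) //= lerDl.
by apply: sumr_ge0 => i _; rewrite invr_ge0.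
Qed.

(** Each step is the inequality [ln (1 - 1/(n+1)) <= - 1/(n+1)]. *)
Lemma harm_ln n : (0 < n)%N -> harm n <= 1 + ln n%:R.
Proof.
elim: n => // n IH _; case: n IH => [|n] IH.
  by rewrite /harm big_nat1 ln1 addr0 invr1.
rewrite /harm big_nat_recr //=; have {}IH := IH isT; rewrite -/(harm _).
have h : ln (1 - n.+2%:R^-1) <= - n.+2%:R^-1 :> R.
  have := @le_ln1Dx R (- n.+2%:R^-1); apply.
  by rewrite ltrN2 invf_lt1 // ltr1n.
have e2 : 1 - n.+2%:R^-1 = n.+1%:R / n.+2%:R :> R.
  have n2 : n.+2%:R != 0 :> R by [].
  by apply/(mulIf n2); rewrite mulfVK // mulrBl mul1r mulVf // -natr1 addrK.
rewrite e2 ln_div ?posrE // in h.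
move: h IH; move: (ln n.+2%:R) (ln n.+1%:R) (harm _) (n.+2%:R^-1) => u v w t.
by lra.
Qed.

(** The threshold is [4] because [expR 1 <= 4], which follows from
    [expR (- 1/2) >= 1/2]. *)
Lemma ln_nat_ge1 n : (4 <= n)%N -> 1 <= ln n%:R :> R.
Proof.
move=> n4; have n0 : 0 < n%:R :> R by rewrite ltr0n; apply: leq_trans n4.
rewrite -[X in X <= _](@expRK R) ler_ln ?posrE ?expR_gt0 //.
apply: (@le_trans _ _ 4%:R); last by rewrite ler_nat.
have h : 1 + (- 2^-1) <= expR (- 2^-1) :> R by apply: expR_ge1Dx.
have -> : 1 = 2^-1 + 2^-1 :> R by field.
have h1 := expRxMexpNx_1 (2^-1 : R).
have h2 := expR_gt0 (2^-1 : R).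
rewrite expRD.
by nra.
Qed.

End Harmonic.

(** * Spacing of the multiples of a rationally approximated number *)

Section Slots.
Variable R : realType.
Variable q : nat.
Hypothesis q0 : (0 < q)%N.

(** The circle is cut into [4 q] slots of equal width. They are not wider than
    the spacing of nearby multiples of [alpha], and the first and last slots
    are the only ones that can hold points too close to an integer. *)
Definition slot (x : R) : nat := Num.truncn ((4 * q)%:R * fpart x).

Lemma slot_itv x : (slot x)%:R <= (4 * q)%:R * fpart x < (slot x).+1%:R.
Proof. by apply: truncn_itv; rewrite mulr_ge0 // fpart_ge0. Qed.

Lemma slot_lt x : (slot x < 4 * q)%N.
Proof.
rewrite -(ltr_nat R); have /andP[h _] := slot_itv x; apply: (le_lt_trans h).
by rewrite gtr_pMr ?fpart_lt1 // ltr0n muln_gt0.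
Qed.

(** A bound for the reciprocal of the distance to the nearest integer, for a
    point of an inner slot [s]; the two terms account for the two sides. In the
    extreme slots, which [kern_slot] treats apart, one of the denominators is
    [0] and the corresponding term vanishes. *)
Definition slot_bound (s : nat) : R :=
  (4 * q)%:R / s%:R + (4 * q)%:R / (4 * q - s.+1)%:R.

Lemma slot_bound_ge0 s : 0 <= slot_bound s.
Proof. by rewrite addr_ge0 // divr_ge0. Qed.

Lemma kern_slot B x : 0 <= B -> 
  kern B x <= B *+ (slot x == 0)%N + B *+ (slot x == (4 * q).-1) + slot_bound (slot x).
Proof.
move=> B0; have sb := slot_bound_ge0 (slot x).
have [s0|s0] /= := eqVneq (slot x) 0%N.
  rewrite mulr1n; have := kern_le x B0.
  have : 0 <= B *+ (slot x == (4 * q).-1) by rewrite mulrn_wge0.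
  by rewrite s0 in sb *; lra.
have [s1|s1] /= := eqVneq (slot x) (4 * q).-1.
  rewrite mulr0n mulr1n; have := kern_le x B0.
  by rewrite s1 in sb *; lra.
rewrite !mulr0n !add0r.
have /andP[h1 h2] := slot_itv x; have h3 := slot_lt x.
have Q0 : 0 < (4 * q)%:R :> R by rewrite ltr0n muln_gt0.
have S0 : 0 < (slot x)%:R :> R by rewrite ltr0n lt0n.
have h4 : (0 < 4 * q - (slot x).+1)%N by move: s1 h3; clear; lia.
have S1 : 0 < (4 * q - (slot x).+1)%:R :> R by rewrite ltr0n.
have e1 : (4 * q - (slot x).+1)%:R = (4 * q)%:R - (slot x).+1%:R :> R.
  by rewrite natrB.
have := chord_fpart x; rewrite ge_min => /orP[] h.
  have h5 : (slot x)%:R / (4 * q)%:R <= chord x.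
    by apply: le_trans h; rewrite ler_pdivrMr // mulrC.
  apply: le_trans (kern_chord B0 _ h5) _; first by rewrite divr_gt0.
  by rewrite invf_div lerDl divr_ge0.
have h5 : (4 * q - (slot x).+1)%:R / (4 * q)%:R <= chord x.
  apply: le_trans h; rewrite ler_pdivrMr // e1 mulrBl mul1r mulrC.
  by rewrite lerD2l lerN2 ltW // mulrC.
apply: le_trans (kern_chord B0 _ h5) _; first by rewrite divr_gt0.
by rewrite invf_div lerDr divr_ge0.
Qed.

Lemma sum_slot_bound :
  \sum_(0 <= s < 4 * q) slot_bound s <= 8 * q%:R * harm R (4 * q).
Proof.
rewrite big_split /=.
have -> : \sum_(0 <= i < 4 * q) (4 * q)%:R / (4 * q - i.+1)%:R =
          \sum_(0 <= i < 4 * q) (4 * q)%:R / i%:R :> R.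
  rewrite big_nat_rev /=; apply: eq_big_nat => i /andP[_ hi].
  by congr (_ / _%:R); lia.
have : \sum_(0 <= i < 4 * q) (4 * q)%:R / i%:R <= (4 * q)%:R * harm R (4 * q).
  rewrite -mulr_sumr ler_wpM2l // big_ltn ?muln_gt0 // invr0 add0r.
  rewrite /harm [X in _ <= X]big_nat_recr ?muln_gt0 //= lerDl invr_ge0 ler0n //.
by rewrite natrM; lra.
Qed.

End Slots.

Lemma le_sum_inj (R : realType) (T : eqType) (s : seq T) (f : T -> nat) (F : nat -> R) M :
  {in s &, injective f} -> uniq s -> {in s, forall x, (f x < M)%N} ->
  (forall i, 0 <= F i) ->
  \sum_(x <- s) F (f x) <= \sum_(0 <= i < M) F i.
Proof.
move=> fi us fM F0.
rewrite -(big_map f predT F) /=.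
have um : uniq (map f s) by rewrite map_inj_in_uniq.
rewrite [X in _ <= X](bigID (fun i => i \in map f s)) /=.
rewrite -[X in _ <= X + _]big_filter -[X in X <= _]addr0 lerD //; last exact: sumr_ge0.
rewrite (@perm_big _ _ _ _ (map f s) [seq i <- index_iota 0 M | i \in map f s]) //=.
apply: uniq_perm => // [|i]; first by rewrite filter_uniq // iota_uniq.
rewrite mem_filter mem_index_iota /=; case: (boolP (i \in map f s)) => //=.
by case/mapP => x xs ->; rewrite fM.
Qed.

Section KernelSum.
Variable R : realType.
Variables (alpha : R) (a : int) (q : nat).
Hypotheses (q0 : (0 < q)%N) (aq : coprimez a q%:Z).
Hypothesis approx : `|alpha - a%:~R / q%:R| <= 1 / q%:R ^+ 2.

(** If [alpha * d] were at most [1 / (4 q)] away from [k], then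
    [a * d - k * q] would be an integer of absolute value at most [3/4], hence
    zero, and coprimality would make [q] divide [d]. *)
Lemma spaced (d : nat) (k : int) : (0 < d)%N -> (2 * d <= q)%N ->
  (4 * q%:R)^-1 < `|alpha * d%:R - k%:~R|.
Proof.
move=> d0 dq; rewrite ltNge; apply/negP => h.
have Q0 : 0 < q%:R :> R by rewrite ltr0n.
have dq' : 2 * d%:R <= q%:R :> R by rewrite -natrM ler_nat.
have e1 : (a * d%:Z - k * q%:Z)%:~R =
    q%:R * ((alpha * d%:R - k%:~R) - d%:R * (alpha - a%:~R / q%:R)) :> R.
  by rewrite intrB !intrM -!pmulrn; field; rewrite gt_eqF.
have h1 : `|(a * d%:Z - k * q%:Z)%:~R| < 1 :> R.
  rewrite e1 normrM (ger0_norm (ltW Q0)).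
  have h2 := ler_normB (alpha * d%:R - k%:~R) (d%:R * (alpha - a%:~R / q%:R)).
  rewrite normrM (ger0_norm (ler0n R d)) in h2.
  have h3 : d%:R * `|alpha - a%:~R / q%:R| <= d%:R * (1 / q%:R ^+ 2).
    by rewrite ler_wpM2l.
  have h4 : d%:R * (1 / q%:R ^+ 2) <= (2 * q%:R)^-1 :> R.
    rewrite div1r ler_pdivrMr ?exprn_gt0 // expr2 invfM mulrA mulfVK ?gt_eqF //.
    by lra.
  apply: (@le_lt_trans _ _ (q%:R * ((4 * q%:R)^-1 + (2 * q%:R)^-1))).
    by rewrite ler_wpM2l ?(ltW Q0) //; lra.
  have -> : q%:R * ((4 * q%:R)^-1 + (2 * q%:R)^-1) = 3 / 4 :> R.
    by field; rewrite gt_eqF.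
  by lra.
have h2 : a * d%:Z - k * q%:Z = 0.
  apply/eqP; rewrite -normr_le0.
  by rewrite -intr_norm (@ltr_int R _ 1) in h1; lia.
have h3 : (q%:Z %| a * d%:Z)%Z.
  by apply/dvdzP; exists k; apply/eqP; rewrite -subr_eq0 h2.
have cq : coprimez q%:Z a by rewrite coprimez_sym.
rewrite (Gauss_dvdzr _ cq) dvdzE /= in h3.
have := dvdn_leq d0 h3.
by move: d0 dq; clear; lia.
Qed.

Lemma slot_inj i j : (i < j)%N -> (2 * (j - i) <= q)%N ->
  slot q (alpha * i%:R) != slot q (alpha * j%:R).
Proof.
move=> ij hq; apply/eqP => h.
have d0 : (0 < j - i)%N by lia.
have := spaced (Num.floor (alpha * j%:R) - Num.floor (alpha * i%:R)) d0 hq.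
have -> : alpha * (j - i)%:R -
   (Num.floor (alpha * j%:R) - Num.floor (alpha * i%:R))%:~R =
   fpart (alpha * j%:R) - fpart (alpha * i%:R).
  by rewrite /fpart (natrB _ (ltnW ij)) intrB; ring.
have /andP[] := slot_itv q (alpha * i%:R); have /andP[] := slot_itv q (alpha * j%:R).
rewrite h -[(slot _ _).+1%:R]natr1; set s := (slot _ _)%:R.
set x := fpart _; set y := fpart _ => h1 h2 h3 h4.
have Q0 : 0 < (4 * q)%:R :> R by rewrite ltr0n muln_gt0.
rewrite -natrM => h5.
have : (4 * q)%:R * `|x - y| <= 1.
  rewrite -[X in X * _]ger0_norm ?(ltW Q0) // -normrM ler_norml mulrBr.
  by apply/andP; split; lra.
rewrite -ler_pdivlMl // mulr1; by move/le_lt_trans/(_ h5); rewrite ltxx.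
Qed.

(* Two indices of a block of length [h] differ by at most [q / 2]. *)
Let h := q./2.+1.
Let slotj j := slot q (alpha * j%:R).

Lemma slot_inj_block b c : (c <= b + h)%N ->
  {in index_iota b c &, injective slotj}.
Proof.
move=> cb i j; rewrite !mem_index_iota /slotj => hi hj hs.
have hh : (2 * h <= q + 2)%N by rewrite /h; lia.
have [ij|ij|//] := ltngtP i j.
  have d : (2 * (j - i) <= q)%N by clear -hi hj hh cb ij; lia.
  by have := slot_inj ij d; rewrite hs eqxx.
have d : (2 * (i - j) <= q)%N by clear -hi hj hh cb ij; lia.
by have := slot_inj ij d; rewrite hs eqxx.
Qed.

Lemma kern_block b B : 0 <= B ->
  \sum_(b <= j < b + h) kern B (alpha * j%:R) <= 2 * B + 8 * q%:R * harm R (4 * q).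
Proof.
move=> B0.
pose F s := B *+ (s == 0)%N + B *+ (s == (4 * q).-1) + slot_bound R q s.
have F0 s : 0 <= F s by rewrite !addr_ge0 ?mulrn_wge0 ?slot_bound_ge0.
apply: (@le_trans _ _ (\sum_(j <- index_iota b (b + h)) F (slotj j))).
  by apply: ler_sum => j _; apply: kern_slot.
apply: le_trans (@le_sum_inj R _ _ _ F (4 * q) _ _ _ F0) _.
- exact: slot_inj_block.
- exact: iota_uniq.
- by move=> j _; apply: slot_lt.
rewrite big_split /=; apply: lerD; last exact: sum_slot_bound.
rewrite big_split /=.
have H c : \sum_(0 <= i < 4 * q) B *+ (i == c) <= B.
  have [hc|hc] := ltnP c (4 * q).
    rewrite (bigD1_seq c) ?mem_index_iota ?iota_uniq //= eqxx mulr1n.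
    by rewrite big1 ?addr0 // => i /negbTE ->.
  rewrite big_nat_cond big1 // => i /andP[/andP[_ hi] _].
  by rewrite (_ : (i == c) = false) //; lia.
have := H 0%N; have := H (4 * q).-1; lra.
Qed.

(** The index [0] may be added to this block, and it occupies the position of
    the integers; hence no other index comes near them, and the large values
    [X / j] do not enter the bound. *)
Lemma kern_block0 (X : R) : 0 <= X ->
  \sum_(1 <= j < h) kern (X / j%:R) (alpha * j%:R) <= 8 * q%:R * harm R (4 * q).
Proof.
move=> X0.
apply: (@le_trans _ _ (\sum_(j <- index_iota 1 h) slot_bound R q (slotj j))).
  rewrite big_nat_cond [X in _ <= X]big_nat_cond.
  apply: ler_sum => j /andP[/andP[j1 jh] _].
  have B0 : 0 <= X / j%:R by rewrite divr_ge0.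
  have hh : (2 * j <= q)%N by move: jh; rewrite /h; lia.
  have Q0 : 0 < (4 * q)%:R :> R by rewrite ltr0n muln_gt0.
  have := kern_slot q0 (alpha * j%:R) B0.
  have /andP[h1 h2] := slot_itv q (alpha * j%:R).
  have -> : (slot q (alpha * j%:R) == 0%N) = false.
    apply/eqP => hs; rewrite hs in h1 h2.
    have := spaced (Num.floor (alpha * j%:R)) j1 hh.
    rewrite -/(fpart _) ger0_norm ?fpart_ge0 // -natrM.
    by rewrite -[X in X < _]mulr1 ltr_pdivrMl // ltNge (ltW h2).
  have -> : (slot q (alpha * j%:R) == (4 * q).-1) = false.
    apply/eqP => hs; rewrite hs in h1 h2.
    have := spaced (Num.floor (alpha * j%:R) + 1) j1 hh.
    rewrite intrD opprD addrA -/(fpart _) distrC ger0_norm; last first.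
      by rewrite subr_ge0 ltW // fpart_lt1.
    rewrite -natrM -[X in X < _]mulr1 ltr_pdivrMl // mulrBr mulr1.
    have e1 : (4 * q)%:R = (4 * q).-1%:R + 1 :> R by rewrite natr1 prednK // muln_gt0.
    by lra.
  by rewrite !mulr0n !add0r.
apply: le_trans (@le_sum_inj R _ _ _ (slot_bound R q) (4 * q) _ _ _ _) (sum_slot_bound R q0).
- by apply: slot_inj_block; rewrite add1n ltnW.
- exact: iota_uniq.
- by move=> j _; apply: slot_lt.
- exact: slot_bound_ge0.
Qed.

Lemma kern_blocks (X : R) T : 0 <= X ->
  \sum_(1 <= j < h * T.+1) kern (X / j%:R) (alpha * j%:R) <=
  2 * X / h%:R * harm R T + T.+1%:R * (8 * q%:R * harm R (4 * q)).
Proof.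
move=> X0; elim: T => [|T IH].
  by rewrite muln1 mul1r /harm [in X in _ <= X + _]big_geq // mulr0 add0r kern_block0.
rewrite mulnS addnC (@big_cat_nat _ _ _ (h * T.+1)) //=; last first.
  by rewrite leq_addr.
have hT : harm R T.+1 = harm R T + T.+1%:R^-1 by rewrite /harm big_nat_recr.
rewrite hT mulrDr -[T.+2%:R]natr1 [(_ + 1) * _]mulrDl mul1r.
have hh : (0 < h)%N by [].
have B0 : 0 <= X / (h * T.+1)%:R by rewrite divr_ge0.
have h2 : \sum_(h * T.+1 <= i < h * T.+1 + h) kern (X / i%:R) (alpha * i%:R)
   <= 2 * (X / (h * T.+1)%:R) + 8 * q%:R * harm R (4 * q).
  apply: le_trans (kern_block _ B0).
  rewrite big_nat_cond [X in _ <= X]big_nat_cond.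
  apply: ler_sum => j /andP[/andP[j1 j2] _].
  have j0 : (0 < j)%N by apply: leq_trans j1; rewrite muln_gt0.
  apply: kern_mono; first by rewrite divr_ge0.
  by rewrite ler_wpM2l // lef_pV2 ?posrE ?ltr0n ?muln_gt0 // ler_nat.
have e1 : 2 * (X / (h * T.+1)%:R) = 2 * X / h%:R / T.+1%:R.
  by rewrite natrM invfM; ring.
rewrite e1 in h2.
apply: le_trans (lerD IH h2) _; rewrite le_eqVlt; apply/orP; left; apply/eqP.
by ring.
Qed.

(** The arithmetic input of the whole proof. Multiples of [alpha] are well
    spread over blocks of about [q / 2] consecutive indices: a block at
    distance [j] from [0] contributes at most [2 * N / j] for the two terms
    that may come near an integer, and [O (q * ln q)] for the others. *)
Lemma kern_sum N J : (4 <= N)%N -> (q <= N)%N -> (J <= N)%N ->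
  \sum_(1 <= j < J.+1) kern (N%:R / j%:R) (alpha * j%:R) <=
  48 * ln N%:R * (N%:R / q%:R + J%:R + q%:R).
Proof.
move=> N4 qN JN; set L := ln N%:R.
have L1 : 1 <= L by apply: ln_nat_ge1.
have hh : (0 < h)%N by [].
have Q0 : 0 < q%:R :> R by rewrite ltr0n.
set T := (J %/ h)%N.
have hq : q%:R <= 2 * h%:R :> R by rewrite -natrM ler_nat /h; lia.
have TJ : T%:R * q%:R <= 2 * J%:R :> R.
  apply: (@le_trans _ _ (T%:R * (2 * h%:R))); first by rewrite ler_wpM2l.
  rewrite mulrCA ler_wpM2l // -natrM ler_nat; exact: leq_trunc_div.
have H4 : harm R (4 * q) <= 3 * L.
  apply: le_trans (harm_ln _ _) _; first by rewrite muln_gt0.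
  rewrite natrM lnM ?posrE ?ltr0n //.
  have : ln 4%:R <= L by rewrite ler_ln ?posrE ?ltr0n ?ler_nat //; lia.
  have : ln q%:R <= L by rewrite ler_ln ?posrE ?ltr0n ?ler_nat //; lia.
  by lra.
have HT : harm R T <= 2 * L.
  apply: (@le_trans _ _ (harm R N)).
    by apply: harm_mono; apply: leq_trans JN; apply: leq_div.
  by apply: le_trans (harm_ln _ _) _; [lia | rewrite -/L; lra].
apply: (@le_trans _ _ (\sum_(1 <= j < h * T.+1) kern (N%:R / j%:R) (alpha * j%:R))).
  have JT : (J.+1 <= h * T.+1)%N by rewrite mulnC ltn_ceil.
  rewrite (@big_cat_nat _ _ _ J.+1 1 (h * T.+1)) //= lerDl.
  by apply: sumr_ge0 => i _; rewrite kern_ge0 // divr_ge0.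
apply: le_trans (kern_blocks _ _) _ => //.
have h1 : 2 * N%:R / h%:R * harm R T <= 8 * L * (N%:R / q%:R).
  have h2 : 2 * N%:R / h%:R <= 4 * (N%:R / q%:R) :> R.
    rewrite ler_pdivrMr ?ltr0n // -!mulrA [q%:R^-1 * _]mulrC mulrA.
    rewrite -[2 * _ in X in X <= _]mulr1 mulrCA.
    have : 1 <= 2 * (h%:R / q%:R) :> R by rewrite mulrA ler_pdivlMr // mul1r.
    have : 0 <= N%:R :> R by [].
    by nra.
  have h3 : 0 <= N%:R / q%:R :> R by rewrite divr_ge0.
  have h4 := harm_ge0 R T.
  by nra.
have h2 : T.+1%:R * (8 * q%:R * harm R (4 * q)) <= 24 * L * (2 * J%:R + q%:R).
  rewrite -natr1.
  have -> : (T%:R + 1) * (8 * q%:R * harm R (4 * q)) =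
     8 * (T%:R * q%:R + q%:R) * harm R (4 * q) by ring.
  apply: (@le_trans _ _ (8 * (T%:R * q%:R + q%:R) * (3 * L))).
    by rewrite ler_wpM2l // mulr_ge0 // addr_ge0 // mulr_ge0.
  by nra.
have h3 : 0 <= N%:R / q%:R :> R by rewrite divr_ge0.
by nra.
Qed.

End KernelSum.

(** * Sums over multiples *)

Lemma sum_multiples (V : nmodType) (N d : nat) (P : pred nat) (h : nat -> V) : (0 < d)%N ->
  \sum_(1 <= k < N.+1 | (d * k <= N)%N && P (d * k)%N) h (d * k)%N =
  \sum_(1 <= n < N.+1 | (d %| n)%N && P n) h n.
Proof.
move=> d0; rewrite -(big_map (muln d) (fun n => (n <= N)%N && P n) h) /=.
rewrite -big_filter -[RHS]big_filter; apply: perm_big; apply: uniq_perm.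
- rewrite filter_uniq // map_inj_uniq ?iota_uniq // => x y /eqP.
  by rewrite eqn_pmul2l // => /eqP.
- by rewrite filter_uniq // iota_uniq.
move=> n; rewrite !mem_filter mem_index_iota; apply/andP/andP.
  case=> /andP[nN Pn] /mapP[k]; rewrite mem_index_iota => /andP[k1 _] e1.
  by rewrite e1 dvdn_mulr //= -e1 Pn ltnS nN e1 muln_gt0 d0 k1.
case=> /andP[/dvdnP[k e1] Pn] /andP[n1 nN]; rewrite -ltnS nN Pn; split=> //.
apply/mapP; exists k; last by rewrite mulnC.
by rewrite mem_index_iota; move: n1 nN; rewrite e1; case: k {e1} => //= k _; nia.
Qed.

Lemma sum_dvd_mul (V : nmodType) (N d : nat) (h : nat -> V) : (0 < d)%N ->
  \sum_(1 <= k < N.+1 | (d * k <= N)%N) h (d * k)%N =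
  \sum_(1 <= n < N.+1 | (d %| n)%N) h n.
Proof.
move=> d0; have := @sum_multiples V N d predT h d0.
rewrite (eq_bigl (fun k => d * k <= N)%N) => [->|k]; last by rewrite andbT.
by apply: eq_bigl => k; rewrite andbT.
Qed.

Lemma sum_le_div (V : nmodType) (N d s : nat) (F : nat -> V) : (0 < d)%N ->
  \sum_(s <= k < N.+1 | (d * k <= N)%N) F k = \sum_(s <= k < (N %/ d).+1) F k.
Proof.
move=> d0; rewrite (@big_nat_widen _ _ _ s (N %/ d).+1 N.+1) ?ltnS ?leq_div //=.
by apply: eq_bigl => k; rewrite ltnS leq_divRL // mulnC.
Qed.

(** * The von Mangoldt and Moebius functions *)

Section Mangoldt.
Variable R : realType.

Definition mangoldt (n : nat) : R :=
  if (1 < n)%N && (n == pdiv n ^ logn (pdiv n) n)%N then ln (pdiv n)%:R else 0.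

Lemma mangoldt_primepow p k : prime p -> mangoldt (p ^ k.+1) = ln p%:R.
Proof.
move=> pp; rewrite /mangoldt pdiv_pfactor // pfactorK // eqxx andbT.
by rewrite -{1}(expn0 p) ltn_exp2l ?prime_gt1.
Qed.

Lemma mangoldt_prime p : prime p -> mangoldt p = ln p%:R.
Proof. by move=> pp; rewrite -{1}(expn1 p) (mangoldt_primepow 0). Qed.

Lemma mangoldt1 : mangoldt 1 = 0. Proof. by []. Qed.

Lemma mangoldt_neq0 n : mangoldt n != 0 ->
  exists p k, [/\ prime p, n = (p ^ k.+1)%N & mangoldt n = ln p%:R].
Proof.
rewrite {1}/mangoldt; case: ifP => [/andP[n1 /eqP e1] _|]; last by rewrite eqxx.
have pp : prime (pdiv n) by rewrite pdiv_prime.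
exists (pdiv n), (logn (pdiv n) n).-1.
have l0 : (0 < logn (pdiv n) n)%N by rewrite logn_gt0 mem_primes pp pdiv_dvd andbT /=; lia.
rewrite prednK //; split=> //.
by rewrite {1}e1 -(prednK l0) mangoldt_primepow.
Qed.

Lemma mangoldt_ge0 n : 0 <= mangoldt n.
Proof.
have [->//|/mangoldt_neq0[p [k [pp _ ->]]]] := eqVneq (mangoldt n) 0.
by rewrite ln_ge0 // ler1n prime_gt0.
Qed.

Lemma mangoldt_le n : mangoldt n <= ln n%:R.
Proof.
have [->|/mangoldt_neq0[p [k [pp -> ->]]]] := eqVneq (mangoldt n) 0.
  by case: n => [|n]; first rewrite ln0 //; rewrite ln_ge0 // ler1n.
rewrite ler_ln ?posrE ?ltr0n ?expn_gt0 ?prime_gt0 // ler_nat.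
by rewrite -{1}(expn1 p) leq_pexp2l // prime_gt0.
Qed.

(** The only prime power that divides [p * m] but not [m] is [p] to the power
    [logn p m + 1]. *)
Lemma sum_mangoldt_step p m N : prime p -> (0 < m)%N -> (p * m <= N)%N ->
  \sum_(1 <= d < N.+1 | (d %| p * m)%N) mangoldt d =
  ln p%:R + \sum_(1 <= d < N.+1 | (d %| m)%N) mangoldt d.
Proof.
move=> pp m0 pmN; rewrite (bigID (fun d => d %| m)%N) /= addrC; congr (_ + _); last first.
  apply: eq_bigl => d; rewrite andbC; case: (boolP (d %| m)%N) => //= h.
  by rewrite dvdn_mull.
pose d0 := (p ^ (logn p m).+1)%N.
have p0 := prime_gt0 pp.
have lpm : logn p (p * m) = (logn p m).+1.
  by rewrite (lognM _ p0 m0) (logn_prime _ pp) eqxx.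
have pm0 : (0 < p * m)%N by rewrite muln_gt0 p0.
have d0pm : (d0 %| p * m)%N.
  by rewrite pfactor_dvdn // lpm.
have d0m : ~~ (d0 %| m)%N by rewrite pfactor_dvdn // ltnn.
have d01 : (0 < d0)%N by rewrite expn_gt0 prime_gt0.
rewrite -big_filter (bigD1_seq d0) ?filter_uniq ?iota_uniq //=; last first.
  rewrite mem_filter d0pm d0m mem_index_iota d01 ltnS /=.
  by apply: leq_trans pmN; apply: dvdn_leq.
rewrite mangoldt_primepow // big_filter_cond big1 ?addr0 // => d /andP[/andP[h1 h2] h3].
apply/eqP; apply: contraT => /mangoldt_neq0[s [k [sp e1 _]]].
have [es|ns] := eqVneq s p.
  move: h1 h2 h3; rewrite e1 es !pfactor_dvdn // lpm ltnS -leqNgt => h1 h2 /eqP[]; congr (_ ^ _)%N.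
  by lia.
case/negP: h2; move: h1; rewrite e1 Gauss_dvdr // coprimeXl //.
by rewrite prime_coprime // dvdn_prime2.
Qed.

Lemma sum_mangoldt n N : (0 < n)%N -> (n <= N)%N ->
  \sum_(1 <= d < N.+1 | (d %| n)%N) mangoldt d = ln n%:R.
Proof.
elim/ltn_ind: n => n IH n0 nN.
have [n1|n1] := leqP n 1.
  have -> : n = 1%N by lia.
  rewrite ln1 big1 // => d; rewrite dvdn1 => /eqP ->; exact: mangoldt1.
have pp := pdiv_prime n1; set p := pdiv n in pp *.
have [m e1] : exists m, n = (p * m)%N.
  by have /dvdnP[m e1] := pdiv_dvd n; exists m; rewrite mulnC.
have p1 := prime_gt1 pp.
have m0 : (0 < m)%N by move: n0; rewrite e1 muln_gt0 => /andP[].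
rewrite e1 in nN *; rewrite sum_mangoldt_step // IH //; last 2 first.
- by rewrite e1 ltn_Pmull.
- by nia.
by rewrite natrM lnM // posrE ltr0n // ltnW.
Qed.

End Mangoldt.

Section Moebius.
Variable R : realType.

Definition moebius (n : nat) : R :=
  \prod_(p <- primes n) (if logn p n == 1%N then -1 else 0).

Lemma moebius1 : moebius 1 = 1.
Proof. by rewrite /moebius big_nil. Qed.

Lemma moebius_le1 n : `|moebius n| <= 1.
Proof.
rewrite /moebius normr_prod; elim/big_rec: _ => // p x _ x1.
by case: ifP => _; rewrite ?normrN1 ?normr0 ?mul1r ?mul0r.
Qed.

Lemma moebius_mul p d : prime p -> (0 < d)%N ->
  moebius (p * d) = if (p %| d)%N then 0 else - moebius d.
Proof.
move=> pp d0; have p0 := prime_gt0 pp.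
have lp : logn p (p * d) = (logn p d).+1 by rewrite lognM // logn_prime // eqxx.
case: ifPn => pd.
  rewrite /moebius (bigD1_seq p) ?primes_uniq //=; last first.
    by rewrite mem_primes pp muln_gt0 p0 d0 dvdn_mulr.
  have : (0 < logn p d)%N by rewrite logn_gt0 mem_primes pp d0 pd.
  by rewrite lp; case: (logn p d) => //= k _; rewrite mul0r.
have l0 : logn p d = 0%N.
  by apply/eqP; rewrite -leqn0 leqNgt logn_gt0 mem_primes pp d0.
have hp : perm_eq (primes (p * d)) (p :: primes d).
  apply: uniq_perm; rewrite /= ?primes_uniq ?andbT //.
    by rewrite mem_primes (negbTE pd) !andbF.
  by move=> s; rewrite primesM // primes_prime // !inE.
rewrite /moebius (perm_big _ hp) /= big_cons lp l0 eqxx mulN1r; congr (- _).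
apply: eq_big_seq => s; rewrite mem_primes => /and3P[sp _ sd].
have /negbTE sp' : s != p by apply: contraNneq pd => <-.
by rewrite lognM // logn_prime // sp' add0n.
Qed.

(** For a prime [p] dividing [n], the map [d |-> p * d] changes the sign of
    [moebius] on the divisors prime to [p], and [moebius] vanishes on the
    other multiples of [p]: the two halves of the sum cancel. *)
Lemma sum_moebius n N : (0 < n)%N -> (n <= N)%N ->
  \sum_(1 <= d < N.+1 | (d %| n)%N) moebius d = (n == 1%N)%:R.
Proof.
move=> n0 nN; have [->|n1] := eqVneq n 1%N.
  rewrite big_nat_cond (eq_bigl (fun d => d == 1%N)); last first.
    move=> d; rewrite dvdn1; case: eqP => [->|]; rewrite ?andbF //=.
    by rewrite andbT; lia.
  rewrite -big_filter (_ : [seq d <- index_iota 1 N.+1 | d == 1%N] = [:: 1%N]) ?big_seq1 ?moebius1 //.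
  rewrite filter_pred1_uniq ?iota_uniq // mem_index_iota; lia.
have {}n1 : (1 < n)%N by lia.
have pp := pdiv_prime n1; set p := pdiv n in pp *.
have [m e1] : exists m, n = (p * m)%N.
  by have /dvdnP[m e1] := pdiv_dvd n; exists m; rewrite mulnC.
have p0 := prime_gt0 pp.
have m0 : (0 < m)%N by move: n0; rewrite e1 muln_gt0 => /andP[].
rewrite (bigID (fun d => p %| d)%N) /= mulr0n.
have -> : \sum_(1 <= d < N.+1 | (d %| n)%N && (p %| d)%N) moebius d =
   \sum_(1 <= d < N.+1 | (d %| m)%N && ~~ (p %| d)%N) - moebius d.
  rewrite (eq_bigl (fun d => (p %| d) && (d %| n))%N); last by move=> d; rewrite andbC.
  rewrite -(sum_multiples N (fun d => d %| n)%N) //.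
  rewrite big_nat_cond [in RHS]big_nat_cond.
  rewrite (eq_bigl (fun k => (0 < k < N.+1)%N && (k %| m)%N)); last first.
    move=> k; rewrite e1 dvdn_pmul2l //; case: (boolP (0 < k < N.+1)%N) => //= _.
    case: (boolP (k %| m)%N); rewrite ?andbF ?andbT // => /(dvdn_leq m0) km.
    by apply: leq_trans nN; rewrite e1 leq_mul2l km orbT.
  rewrite (bigID (fun k => p %| k)%N) /= big1 ?add0r => [|k /andP[/andP[/andP[k0 _] _] pk]].
    apply: eq_big => [k|k /andP[/andP[/andP[k0 _] _] pk]]; first by rewrite andbA.
    by rewrite moebius_mul // (negbTE pk).
  by rewrite moebius_mul // pk.
rewrite sumrN addrC.
rewrite (eq_bigl (fun d => (d %| m)%N && ~~ (p %| d)%N)) ?subrr // => d.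
rewrite e1; case: (boolP (p %| d)%N); rewrite ?andbF ?andbT // => pd.
by rewrite Gauss_dvdr // coprime_sym prime_coprime.
Qed.

End Moebius.

(** * Counting divisors and prime powers *)

Lemma le_sum_term (R : numDomainType) (T : eqType) (s : seq T) (P : pred T)
    (F : T -> R) x :
  (forall y, 0 <= F y) -> uniq s -> x \in s -> P x ->
  F x <= \sum_(y <- s | P y) F y.
Proof.
move=> F0 us xs Px; rewrite -big_filter (bigD1_seq x) ?filter_uniq ?mem_filter ?Px //=.
by rewrite lerDl sumr_ge0.
Qed.

Section Divisors.
Variable R : realType.

(** The number of divisors of [n], for [0 < n <= N]; the bound [N] makes all
    sums range over the same interval, so that they can be exchanged. *)
Definition tau (N n : nat) : R := \sum_(1 <= d < N.+1 | (d %| n)%N) 1.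

Lemma tau_ge0 N n : 0 <= tau N n.
Proof. exact: sumr_ge0. Qed.

(** A divisor [x] of [d * k] is determined by the divisor [gcdn x d] of [d] and
    the divisor [x / gcdn x d] of [k]. *)
Lemma tau_mul N d k : (0 < d)%N -> (0 < k)%N -> (d * k <= N)%N ->
  tau N (d * k) <= tau N d * tau N k.
Proof.
move=> d0 k0 dkN.
pose F x g y : R := ((x == g * y)%N)%:R.
apply: (@le_trans _ _ (\sum_(1 <= x < N.+1 | (x %| d * k)%N)
  \sum_(1 <= g < N.+1 | (g %| d)%N) \sum_(1 <= y < N.+1 | (y %| k)%N) F x g y)).
  rewrite /tau big_nat_cond [X in _ <= X]big_nat_cond.
  apply: ler_sum => x /andP[/andP[x0 _] xdk].
  have gx0 : (0 < gcdn x d)%N by rewrite gcdn_gt0 x0.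
  have e1 : (gcdn x d * (x %/ gcdn x d))%N = x by rewrite mulnC divnK // dvdn_gcdl.
  have y0 : (0 < x %/ gcdn x d)%N by rewrite divn_gt0 // dvdn_leq // dvdn_gcdl.
  have yk : (x %/ gcdn x d %| k)%N.
    rewrite -(@Gauss_dvdr _ (d %/ gcdn x d)%N); last first.
      rewrite /coprime -(eqn_pmul2r gx0) muln_gcdl mul1n.
      by rewrite !divnK ?dvdn_gcdl ?dvdn_gcdr.
    rewrite -(@dvdn_pmul2l (gcdn x d)) // e1 mulnA [(gcdn x d * _)%N]mulnC divnK //.
    by rewrite dvdn_gcdr.
  have dN : (gcdn x d < N.+1)%N.
    by rewrite ltnS (leq_trans _ dkN) // (leq_trans (dvdn_leq d0 (dvdn_gcdr x d))) // leq_pmulr.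
  have kN : (x %/ gcdn x d < N.+1)%N.
    by rewrite ltnS (leq_trans _ dkN) // (leq_trans (dvdn_leq k0 yk)) // leq_pmull.
  have F0 g y : 0 <= F x g y by [].
  apply: (le_trans _ (@le_sum_term _ _ _ _ _ (gcdn x d) _ _ _ _)).
  - apply: (le_trans _ (@le_sum_term _ _ _ _ _ (x %/ gcdn x d)%N _ _ _ _)).
    + by rewrite /F e1 eqxx.
    + exact: F0.
    + exact: iota_uniq.
    + by rewrite mem_index_iota y0.
    + exact: yk.
  - by move=> g; apply: sumr_ge0.
  - exact: iota_uniq.
  - by rewrite mem_index_iota gx0.
  - exact: dvdn_gcdr.
rewrite exchange_big /= /tau mulr_suml.
apply: ler_sum => g _; rewrite exchange_big /= mul1r.
apply: ler_sum => y _; rewrite /F -big_filter.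
have us : uniq [seq i <- index_iota 1 N.+1 | (i %| d * k)%N] by rewrite filter_uniq // iota_uniq.
case: (boolP ((g * y)%N \in [seq i <- index_iota 1 N.+1 | (i %| d * k)%N])) => h.
  by rewrite (bigD1_seq (g * y)%N) //= eqxx big1 ?addr0 // => i /negbTE ->.
rewrite big_seq big1 // => i hi; case: eqP => // e1.
by rewrite -e1 hi in h.
Qed.

(** Opening one of the two factors [tau] as a sum over divisors and using
    submultiplicativity for the other reduces the sum to the square of the sum
    of [tau m / m], and the same opening bounds the latter by [harm ^ 2]. *)
Lemma sum_tau_sq N : \sum_(1 <= m < N.+1) tau N m ^+ 2 / m%:R <= harm R N ^+ 4.
Proof.
have tau_sum (F : nat -> R) : \sum_(1 <= m < N.+1) tau N m * F m =
    \sum_(1 <= d < N.+1) \sum_(1 <= k < N.+1 | (d * k <= N)%N) F (d * k)%N.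
  rewrite /tau; under eq_bigr do rewrite mulr_suml.
  rewrite (exchange_big_dep predT) //= [LHS]big_nat_cond [RHS]big_nat_cond.
  apply: eq_bigr => d /andP[/andP[d0 _] _].
  by rewrite sum_dvd_mul //; apply: eq_bigr => k _; rewrite mul1r.
have cut (F : nat -> R) d : (forall k, 0 <= F k) ->
   \sum_(1 <= k < N.+1 | (d * k <= N)%N) F k <= \sum_(1 <= k < N.+1) F k.
  move=> F0; rewrite [X in _ <= X](bigID (fun k => d * k <= N)%N) /= lerDl.
  exact: sumr_ge0.
have t0 := tau_ge0 N; have H0 := harm_ge0 R N.
have tau_harm : \sum_(1 <= m < N.+1) tau N m / m%:R <= harm R N ^+ 2.
  rewrite tau_sum expr2 {1}/harm mulr_suml; apply: ler_sum => d _.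
  apply: le_trans (cut _ _ _) _ => [k|]; first by rewrite invr_ge0.
  by rewrite mulr_sumr ler_sum // => k _; rewrite natrM invfM.
have -> : \sum_(1 <= m < N.+1) tau N m ^+ 2 / m%:R = \sum_(1 <= m < N.+1) tau N m * (tau N m / m%:R).
  by apply: eq_bigr => m _; rewrite expr2 mulrA.
set S := \sum_(1 <= m < N.+1) _ / _ in tau_harm.
apply: (@le_trans _ _ (S * S)).
  rewrite tau_sum {1}/S mulr_suml.
  rewrite big_nat_cond [X in _ <= X]big_nat_cond.
  apply: ler_sum => d /andP[/andP[d0 _] _].
  apply: (@le_trans _ _ (\sum_(1 <= k < N.+1 | (d * k <= N)%N) (tau N d / d%:R * (tau N k / k%:R)))).
    rewrite big_nat_cond [X in _ <= X]big_nat_cond.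
    apply: ler_sum => k /andP[/andP[k0 _] dk].
    rewrite natrM invfM mulrACA ler_wpM2r ?tau_mul // mulr_ge0 // invr_ge0 //.
  rewrite -mulr_sumr ler_wpM2l ?divr_ge0 // cut // => k.
  by rewrite divr_ge0.
have S0 : 0 <= S by apply: sumr_ge0 => m _; rewrite divr_ge0.
by rewrite (_ : 4 = 2 + 2)%N // exprD ler_pM.
Qed.

Lemma ln2_ge : 1 / 2 <= ln 2 :> R.
Proof.
have := @ln_nat_ge1 R 4 isT; have -> : 4%:R = 2 * 2 :> R by ring.
by rewrite lnM ?posrE //; lra.
Qed.

(** The constant [2] comes from [ln 2 >= 1/2]. *)
Lemma log2_le k N : (0 < N)%N -> (2 ^ k <= N)%N -> k%:R <= 2 * ln N%:R :> R.
Proof.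
move=> N0 h.
have : ln (2 ^+ k) <= ln N%:R :> R.
  by rewrite ler_ln ?posrE ?exprn_gt0 ?ltr0n // -natrX ler_nat.
rewrite lnXn // -[ln 2 *+ k]mulr_natl => h1.
have h2 : k%:R * (1 / 2) <= k%:R * ln 2 :> R by rewrite ler_wpM2l // ln2_ge.
by lra.
Qed.

(** The product of the primes dividing [j] is at most [N], and each is at
    least [2]. *)
Lemma prime_divisors_le N U j : (4 <= N)%N -> (0 < j)%N -> (j <= N)%N ->
  \sum_(1 <= r < U.+1 | prime r && (r %| j)%N) 1 <= 2 * ln N%:R :> R.
Proof.
move=> N4 j0 jN.
have N0 : (0 < N)%N by apply: leq_trans jN.
have h1 : (size [seq r <- index_iota 1 U.+1 | prime r && (r %| j)%N] <= size (primes j))%N.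
  apply: uniq_leq_size; first by rewrite filter_uniq // iota_uniq.
  by move=> r; rewrite mem_filter mem_primes j0 => /andP[/andP[-> ->]].
have h2 : (2 ^ size (primes j) <= j)%N.
  rewrite [X in (_ <= X)%N]prod_prime_decomp // prime_decompE big_map /=.
  have : {in primes j, forall p, 2 <= p ^ logn p j}%N.
    move=> p; rewrite -logn_gt0 => l0.
    have pp : prime p by move: l0; rewrite logn_gt0 mem_primes => /andP[].
    by apply: leq_trans (prime_gt1 pp) _; rewrite -{1}(expn1 p) leq_pexp2l // prime_gt0.
  elim: (primes j) => [|p s IH] hs; first by rewrite big_nil.
  rewrite big_cons /= expnS leq_mul ?hs ?mem_head // IH // => r rs.
  by rewrite hs // inE rs orbT.
apply: (@le_trans _ _ (size (primes j))%:R).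
  by rewrite -big_filter big_const_seq count_predT iter_addr addr0 ler_nat.
by apply: log2_le => //; apply: leq_trans jN.
Qed.

(** Such a [c] is [p ^ k] with [k >= 2], so that [p <= s] and [2 ^ k <= N]. *)
Lemma count_primepow N M s : (0 < N)%N -> (M <= N)%N -> (N < s.+1 ^ 2)%N ->
  \sum_(1 <= c < M.+1 | ~~ prime c && (mangoldt R c != 0)) 1 <= s%:R * (2 * ln N%:R) :> R.
Proof.
move=> N0 MN Ns; set l := trunc_log 2 N.
have l2 : l%:R <= 2 * ln N%:R :> R by apply: log2_le => //; apply: trunc_logP.
apply: (@le_trans _ _ (s%:R * l%:R)); last by rewrite ler_wpM2l.
pose F c p k : R := ((c == p ^ k)%N)%:R.
apply: (@le_trans _ _ (\sum_(1 <= c < M.+1)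
  \sum_(1 <= p < s.+1) \sum_(1 <= k < l.+1) F c p k)).
  rewrite big_mkcond /= big_nat_cond [X in _ <= X]big_nat_cond.
  apply: ler_sum => c /andP[/andP[c0 cM] _]; case: ifPn; last first.
    by move=> _; apply: sumr_ge0 => p _; apply: sumr_ge0.
  move=> /andP[np /mangoldt_neq0[p [k [pp e1 _]]]].
  have p1 := prime_gt1 pp.
  have k0 : (0 < k)%N by case: k e1 np => // e1; rewrite e1 expn1 pp.
  have cN : (p ^ k.+1 <= N)%N by rewrite -e1; move: cM MN; rewrite ltnS; apply: leq_trans.
  have ps : (p < s.+1)%N.
    rewrite -(@ltn_exp2r _ _ 2) // (leq_ltn_trans _ Ns) // (leq_trans _ cN) //.
    by rewrite leq_pexp2l // ltnW.
  have kl : (k.+1 <= l)%N.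
    by apply: trunc_log_max => //; apply: leq_trans cN; rewrite leq_exp2r.
  have F0 p' k' : 0 <= F c p' k' by [].
  apply: (le_trans _ (@le_sum_term _ _ _ _ _ p _ _ _ _)) => //.
  - apply: (le_trans _ (@le_sum_term _ _ _ _ _ k.+1 _ _ _ _)) => //.
    + by rewrite /F e1 eqxx.
    + exact: iota_uniq.
    + by rewrite mem_index_iota.
  - by move=> p'; apply: sumr_ge0.
  - exact: iota_uniq.
  - by rewrite mem_index_iota (ltnW p1).
rewrite exchange_big /=.
have -> : s%:R * l%:R = \sum_(1 <= p < s.+1) \sum_(1 <= k < l.+1) 1 :> R.
  by rewrite !sumr_const_nat !subn1 /= -natrM mulnC mulrnA.
apply: ler_sum => p _; rewrite exchange_big /=; apply: ler_sum => k _.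
case: (boolP ((p ^ k)%N \in index_iota 1 M.+1)) => h.
  by rewrite (bigD1_seq (p ^ k)%N) ?iota_uniq //= /F eqxx big1 ?addr0 // => i /negbTE ->.
rewrite big_seq big1 // => i hi; rewrite /F; case: eqP => // e1.
by rewrite -e1 hi in h.
Qed.

End Divisors.

(** * Vaughan's identity *)

Section Vaughan.
Variable R : realType.
Implicit Types f : nat -> R[i].

Definition trunc_moebius (V m : nat) : R :=
  \sum_(1 <= b < V.+1 | (b %| m)%N) moebius R b.

Lemma trunc_moebius_small V m : (0 < m <= V)%N -> trunc_moebius V m = (m == 1%N)%:R.
Proof. by case/andP => m0 mV; apply: sum_moebius. Qed.

Lemma trunc_moebius_le V N m : (V <= N)%N -> `|trunc_moebius V m| <= tau R N m.
Proof.
move=> VN; apply: le_trans (ler_norm_sum _ _ _) _.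
apply: (@le_trans _ _ (\sum_(1 <= b < V.+1 | (b %| m)%N) 1)).
  by apply: ler_sum => b _; apply: moebius_le1.
rewrite /tau [X in _ <= X](@big_cat_nat _ _ _ V.+1) //= lerDl.
exact: sumr_ge0.
Qed.

(** Group the terms by the value [n = c * k]. *)
Lemma regroup (N D d : nat) (w : nat -> R) f : (0 < d)%N ->
  \sum_(1 <= c < D.+1) (w c)%:C * \sum_(1 <= k < N.+1 | (d * c * k <= N)%N) f (d * c * k)%N =
  \sum_(1 <= n < N.+1 | (d * n <= N)%N) (\sum_(1 <= c < D.+1 | (c %| n)%N) w c)%:C * f (d * n)%N.
Proof.
move=> d0.
transitivity (\sum_(1 <= c < D.+1) \sum_(1 <= n < N.+1 | (c %| n)%N && (d * n <= N)%N)
   (w c)%:C * f (d * n)%N).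
  rewrite big_nat_cond [RHS]big_nat_cond; apply: eq_bigr => c /andP[/andP[c0 _] _].
  rewrite -mulr_sumr; congr (_ * _).
  rewrite -(sum_multiples N (fun n => d * n <= N)%N (fun n => f (d * n)%N)) //.
  apply: eq_big => [k|k _]; last by rewrite mulnA.
  rewrite mulnA; case: (boolP (d * c * k <= N)%N); rewrite ?andbF ?andbT // => h.
  by apply/esym; apply: leq_trans h; rewrite leq_mul2r leq_pmull // orbT.
rewrite (exchange_big_dep (fun n => d * n <= N)%N) /=; last by move=> c n _ /andP[].
apply: eq_bigr => n hn; rewrite rmorph_sum mulr_suml /=.
by apply: eq_bigl => c; rewrite hn andbT.
Qed.

(** Both sides of the identity arise from one triple sum over [b <= V < c] of
    [moebius b * mangoldt c * f (b * c * k)]: summing over [b] first produces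
    the truncated Moebius sum, which vanishes for [1 < m <= V]; summing over
    [c] first produces [ln] minus the part with [c <= V]. *)
Lemma vaughan V N f : (0 < V)%N -> (V <= N)%N ->
  \sum_(V.+1 <= c < N.+1) (mangoldt R c)%:C * f c =
  \sum_(1 <= b < V.+1) (moebius R b)%:C *
     \sum_(1 <= k < N.+1 | (b * k <= N)%N) (ln k%:R)%:C * f (b * k)%N
  - \sum_(1 <= b < V.+1) (moebius R b)%:C * \sum_(1 <= c < V.+1) (mangoldt R c)%:C *
     \sum_(1 <= k < N.+1 | (b * c * k <= N)%N) f (b * c * k)%N
  - \sum_(V.+1 <= c < N.+1) (mangoldt R c)%:C *
     \sum_(V.+1 <= m < N.+1 | (c * m <= N)%N) (trunc_moebius V m)%:C * f (c * m)%N.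
Proof.
move=> V0 VN.
pose S b c := \sum_(1 <= k < N.+1 | (b * c * k <= N)%N) f (b * c * k)%N.
pose T := \sum_(1 <= b < V.+1) (moebius R b)%:C *
  \sum_(V.+1 <= c < N.+1) (mangoldt R c)%:C * S b c.
have T1 : T = \sum_(1 <= b < V.+1) (moebius R b)%:C *
     \sum_(1 <= k < N.+1 | (b * k <= N)%N) (ln k%:R)%:C * f (b * k)%N
  - \sum_(1 <= b < V.+1) (moebius R b)%:C * \sum_(1 <= c < V.+1) (mangoldt R c)%:C * S b c.
  rewrite -sumrB /T big_nat_cond [RHS]big_nat_cond.
  apply: eq_bigr => b /andP[/andP[b0 _] _]; rewrite -mulrBr; congr (_ * _).
  have <- : \sum_(1 <= c < N.+1) (mangoldt R c)%:C * S b c =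
     \sum_(1 <= k < N.+1 | (b * k <= N)%N) (ln k%:R)%:C * f (b * k)%N.
    rewrite /S regroup // big_nat_cond [RHS]big_nat_cond.
    apply: eq_bigr => n /andP[/andP[n0 nN] _].
    by rewrite sum_mangoldt.
  by rewrite [X in _ = X - _](@big_cat_nat _ _ _ V.+1) //= addrAC subrr add0r.
have T2 : T = \sum_(V.+1 <= c < N.+1) (mangoldt R c)%:C *
     (f c + \sum_(V.+1 <= m < N.+1 | (c * m <= N)%N) (trunc_moebius V m)%:C * f (c * m)%N).
  rewrite /T; under eq_bigr do rewrite mulr_sumr.
  rewrite exchange_big /= big_nat_cond [RHS]big_nat_cond.
  apply: eq_bigr => c /andP[/andP[cV cN] _].
  have c0 : (0 < c)%N by apply: leq_ltn_trans cV.
  under eq_bigr do rewrite mulrCA.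
  rewrite -mulr_sumr; congr (_ * _).
  have -> : \sum_(1 <= b < V.+1) (moebius R b)%:C * S b c =
      \sum_(1 <= n < N.+1 | (c * n <= N)%N) (trunc_moebius V n)%:C * f (c * n)%N.
    rewrite -regroup //; apply: eq_bigr => b _; congr (_ * _); rewrite /S.
    by apply: eq_big => [k|k _]; rewrite [(b * c)%N]mulnC.
  rewrite (@big_cat_nat _ _ _ V.+1) //=; congr (_ + _).
  rewrite big_ltn_cond ?ltnS // muln1 -ltnS cN.
  rewrite trunc_moebius_small ?V0 // eqxx mul1r big_nat_cond big1 ?addr0 //.
  move=> n /andP[/andP[n1 nV] _].
  by rewrite trunc_moebius_small ?(ltnW n1) // gtn_eqF // mul0r.
have -> : \sum_(V.+1 <= c < N.+1) (mangoldt R c)%:C * f c = T -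
  \sum_(V.+1 <= c < N.+1) (mangoldt R c)%:C *
     \sum_(V.+1 <= m < N.+1 | (c * m <= N)%N) (trunc_moebius V m)%:C * f (c * m)%N.
  by rewrite T2 -sumrB; apply: eq_bigr => c _; ring.
by rewrite T1.
Qed.

End Vaughan.

(** * Linear sums *)

Section TypeI.
Variable R : realType.
Variable alpha : R.

Lemma ratio_le N d : (N %/ d)%:R <= N%:R / d%:R :> R.
Proof.
case: d => [|d]; first by rewrite divn0 invr0 mulr0.
by rewrite ler_pdivlMr // -natrM ler_nat leq_trunc_div.
Qed.

Lemma linear_kern N d s t (x : R) : (0 < s)%N -> (t <= (N %/ d).+1)%N ->
  normc (\sum_(s <= k < t) e (k%:R * x)) <= 3 * kern (N%:R / d%:R) x.
Proof.
move=> s0 ht; apply: geometric_kern; apply: le_trans (ratio_le _ _).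
by rewrite ler_nat leq_subLR; apply: leq_trans ht _; rewrite -add1n leq_add2r.
Qed.

Lemma e_mulnat d k : e (alpha * (d * k)%:R) = e (k%:R * (alpha * d%:R)) :> R[i].
Proof. by rewrite natrM mulrA mulrC. Qed.

(** For [b = 1] the quotient is [1] from [k = 2] on, and [0] at [k = 1] since
    the inverse of [ln 1 = 0] is [0]; so monotonicity includes that case. *)
Lemma ln_quot_mono b k : (0 < b)%N -> (0 < k)%N ->
  ln k%:R / ln (b * k)%:R <= ln k.+1%:R / ln (b * k.+1)%:R :> R.
Proof.
move=> b0 k0; have lb : 0 <= ln b%:R :> R by rewrite ln_ge0 // ler1n.
have [k1|k1] := leqP k 1.
  have -> : k = 1%N by lia.
  by rewrite ln1 mul0r divr_ge0 // ln_ge0 // ler1n ?muln_gt0 ?b0.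
rewrite !natrM !lnM ?posrE ?ltr0n //.
have lk : 0 < ln k%:R :> R by rewrite ln_gt0 // ltr1n.
have lk1 : ln k%:R <= ln k.+1%:R :> R by rewrite ler_ln ?posrE ?ltr0n ?ler_nat.
rewrite ler_pdivrMr ?ltr_wpDl // mulrAC ler_pdivlMr; last first.
  by rewrite ltr_wpDl // (lt_le_trans lk).
by nra.
Qed.

Lemma ln_quot_itv b k : (0 < b)%N -> (0 < k)%N ->
  0 <= (ln k%:R / ln (b * k)%:R : R) <= 1.
Proof.
move=> b0 k0; have lb : 0 <= ln b%:R :> R by rewrite ln_ge0 // ler1n.
have lk : 0 <= ln k%:R :> R by rewrite ln_ge0 // ler1n.
rewrite natrM lnM ?posrE ?ltr0n // divr_ge0 ?addr_ge0 //=.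
have [->|h] := eqVneq (ln b%:R + ln k%:R) (0 : R); first by rewrite invr0 mulr0.
by rewrite ler_pdivrMr ?mul1r ?lerDr // lt_neqAle eq_sym h addr_ge0.
Qed.

Lemma typeI_log N b : (0 < b)%N ->
  normc (\sum_(1 <= k < (N %/ b).+1)
     (ln k%:R / ln (b * k)%:R)%:C * e (alpha * (b * k)%:R)) <=
  6 * kern (N%:R / b%:R) (alpha * b%:R).
Proof.
move=> b0; under eq_bigr do rewrite e_mulnat.
have K0 : 0 <= kern (N%:R / b%:R) (alpha * b%:R) by rewrite kern_ge0 // divr_ge0.
apply: le_trans (abel_incr (W := 1) (B := 3 * kern (N%:R / b%:R) (alpha * b%:R)) _ _ _ _ _) _.
- by rewrite mulr_ge0.
- by move=> m /andP[m0 _]; apply: ln_quot_itv.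
- by move=> m m0 _; apply: ln_quot_mono.
- exact: ler01.
- by move=> t' ht; apply: linear_kern.
- by lra.
Qed.

Lemma inv_ln_mono m n : (1 < m)%N -> (m <= n)%N -> (ln n%:R)^-1 <= (ln m%:R)^-1 :> R.
Proof.
move=> m1 mn; have n1 := leq_trans m1 mn.
rewrite lef_pV2 ?posrE ?ln_gt0 ?ltr1n // ler_ln ?posrE ?ltr0n ?ler_nat //; by lia.
Qed.

Lemma inv_ln_ge0 n : 0 <= (ln n%:R)^-1 :> R.
Proof.
by case: n => [|n]; rewrite invr_ge0; [rewrite ln0 | rewrite ln_ge0 // ler1n].
Qed.

Lemma typeI_inv N d : (1 < d)%N ->
  normc (\sum_(1 <= k < (N %/ d).+1) (ln (d * k)%:R)^-1%:C * e (alpha * (d * k)%:R)) <=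
  (ln d%:R)^-1 * (3 * kern (N%:R / d%:R) (alpha * d%:R)).
Proof.
move=> d1; under eq_bigr do rewrite e_mulnat.
have K0 : 0 <= kern (N%:R / d%:R) (alpha * d%:R) by rewrite kern_ge0 // divr_ge0.
apply: (abel_decr (w := fun k => (ln (d * k)%:R)^-1)).
- by rewrite mulr_ge0.
- by move=> m _; apply: inv_ln_ge0.
- move=> m m0 _; apply: inv_ln_mono; first by rewrite (leq_trans d1) // leq_pmulr.
  by rewrite leq_mul2l leqnSn orbT.
- by rewrite muln1.
- exact: inv_ln_ge0.
- by move=> t' ht; apply: linear_kern.
Qed.

(** Group the terms by [d = b * c] and use that [mangoldt] sums to [ln d] over
    the divisors of [d]. The factor [ln d] so produced is compensated, in the
    application, by the weight [1 / ln] of the primes. *)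
Lemma sum_mangoldt_conv V (H : nat -> R) : (forall n, 0 <= H n) ->
  \sum_(1 <= b < V.+1) \sum_(1 <= c < V.+1) mangoldt R c * H (b * c)%N <=
  \sum_(1 <= d < (V * V).+1) ln d%:R * H d.
Proof.
move=> H0; have VV : (V <= V * V)%N by case: V => // V; rewrite leq_pmulr.
have L0 := mangoldt_ge0 R.
rewrite exchange_big /=.
apply: (@le_trans _ _ (\sum_(1 <= c < (V * V).+1)
    \sum_(1 <= d < (V * V).+1 | (c %| d)%N) mangoldt R c * H d)).
  rewrite [X in _ <= X](@big_cat_nat _ _ _ V.+1) //= -[X in X <= _]addr0 lerD //; last first.
    by apply: sumr_ge0 => c _; apply: sumr_ge0 => d _; rewrite mulr_ge0.
  rewrite big_nat_cond [X in _ <= X]big_nat_cond.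
  apply: ler_sum => c /andP[/andP[c0 cV] _].
  rewrite -(sum_dvd_mul (V * V) (fun d => mangoldt R c * H d)) //.
  rewrite [X in _ <= X]big_mkcond (@big_cat_nat _ _ _ V.+1 1 (V * V).+1) //=.
  rewrite -[X in X <= _]addr0 lerD //; last first.
    by apply: sumr_ge0 => b _; case: ifP => // _; rewrite mulr_ge0.
  rewrite big_nat_cond [X in _ <= X]big_nat_cond.
  apply: ler_sum => b /andP[/andP[b0 bV] _].
  by rewrite leq_mul // mulnC.
rewrite (exchange_big_dep predT) //= big_nat_cond [X in _ <= X]big_nat_cond.
apply: ler_sum => d /andP[/andP[d0 dV] _].
by rewrite -mulr_suml sum_mangoldt.
Qed.

(** For [f n = e (alpha * n) / ln n], the inner sums of the two linear parts
    of Vaughan's identity have monotone weights, so each is controlled by one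
    value of [kern]; [sum_mangoldt_conv] disposes of the coefficients
    [mangoldt c] of the second part. *)
Lemma typeI_bound V N : 
  normc (\sum_(1 <= b < V.+1) (moebius R b)%:C *
     (\sum_(1 <= k < N.+1 | (b * k <= N)%N)
       (ln k%:R)%:C * ((ln (b * k)%:R)^-1%:C * e (alpha * (b * k)%:R))) 
  - \sum_(1 <= b < V.+1) (moebius R b)%:C * \sum_(1 <= c < V.+1) (mangoldt R c)%:C *
     \sum_(1 <= k < N.+1 | (b * c * k <= N)%N)
       ((ln (b * c * k)%:R)^-1%:C * e (alpha * (b * c * k)%:R))) <=
  9 * \sum_(1 <= d < (V * V).+1) kern (N%:R / d%:R) (alpha * d%:R).
Proof.
have VV : (V <= V * V)%N by case: V => // V; rewrite leq_pmulr.
have K0 d : 0 <= kern (N%:R / d%:R) (alpha * d%:R) by rewrite kern_ge0 // divr_ge0.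
have mu1 b : normc (moebius R b)%:C <= 1 by rewrite normc_real moebius_le1.
apply: le_trans (le_normcD _ _) _; rewrite normcN.
have h1 : normc (\sum_(1 <= b < V.+1) (moebius R b)%:C *
     (\sum_(1 <= k < N.+1 | (b * k <= N)%N)
       (ln k%:R)%:C * ((ln (b * k)%:R)^-1%:C * e (alpha * (b * k)%:R)))) <=
   6 * \sum_(1 <= d < (V * V).+1) kern (N%:R / d%:R) (alpha * d%:R).
  rewrite [X in 6 * X](@big_cat_nat _ _ _ V.+1) //= mulrDr.
  rewrite -[X in X <= _]addr0 lerD //; last by rewrite mulr_ge0 // sumr_ge0.
  apply: le_trans (le_normc_sum _ _ _) _; rewrite mulr_sumr.
  rewrite big_nat_cond [X in _ <= X]big_nat_cond.
  apply: ler_sum => b /andP[/andP[b0 _] _].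
  rewrite normcM; apply: le_trans (ler_pM (normc_ge0 _) (normc_ge0 _) (mu1 _) (lexx _)) _.
  rewrite mul1r sum_le_div //.
  under eq_bigr do rewrite mulrA -rmorphM /=.
  exact: typeI_log.
have h2 : normc (\sum_(1 <= b < V.+1) (moebius R b)%:C * \sum_(1 <= c < V.+1) (mangoldt R c)%:C *
     \sum_(1 <= k < N.+1 | (b * c * k <= N)%N)
       ((ln (b * c * k)%:R)^-1%:C * e (alpha * (b * c * k)%:R))) <=
   3 * \sum_(1 <= d < (V * V).+1) kern (N%:R / d%:R) (alpha * d%:R).
  pose H d := (ln d%:R)^-1 * (3 * kern (N%:R / d%:R) (alpha * d%:R)).
  apply: (@le_trans _ _ (\sum_(1 <= b < V.+1) \sum_(1 <= c < V.+1) mangoldt R c * H (b * c)%N)).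
    apply: le_trans (le_normc_sum _ _ _) _.
    rewrite big_nat_cond [X in _ <= X]big_nat_cond.
    apply: ler_sum => b /andP[/andP[b0 _] _].
    rewrite normcM; apply: le_trans (ler_pM (normc_ge0 _) (normc_ge0 _) (mu1 _) (lexx _)) _.
    rewrite mul1r; apply: le_trans (le_normc_sum _ _ _) _.
    rewrite big_nat_cond [X in _ <= X]big_nat_cond.
    apply: ler_sum => c /andP[/andP[c0 _] _].
    rewrite normcM normc_real ger0_norm ?mangoldt_ge0 //.
    have [->|Lc] := eqVneq (mangoldt R c) 0; first by rewrite !mul0r.
    have c1 : (1 < c)%N by case: c c0 Lc => [|[|c]] //; rewrite mangoldt1 eqxx.
    rewrite ler_wpM2l ?mangoldt_ge0 // sum_le_div ?muln_gt0 ?b0 //.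
    by apply: typeI_inv; rewrite (leq_trans c1) // leq_pmull.
  apply: le_trans (sum_mangoldt_conv _ _) _.
    by move=> d; rewrite mulr_ge0 ?inv_ln_ge0 // mulr_ge0.
  rewrite mulr_sumr; apply: ler_sum => d _; rewrite /H mulrA.
  have [->|h] := eqVneq (ln d%:R) (0 : R); first by rewrite !mul0r mulr_ge0.
  by rewrite mulfV // mul1r.
by lra.
Qed.

End TypeI.

Section Multiplicity.
Variable R : realType.

(** An index [j = r * d] is reached once for each of its divisors [r] in [P].
    This is how the small prime [r] is merged with the other variables, so
    that only multiples of [alpha] itself have to be studied. *)
Lemma sum_multiplicity (P : pred nat) U D N (G : R) (F : nat -> R) :
  (forall n, 0 <= F n) -> (U * D <= N)%N ->
  (forall j, (0 < j <= N)%N -> \sum_(1 <= r < U.+1 | P r && (r %| j)%N) 1 <= G) ->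
  \sum_(1 <= r < U.+1 | P r) \sum_(1 <= d < D.+1) F (r * d)%N <=
  G * \sum_(1 <= j < (U * D).+1) F j.
Proof.
move=> F0 UDN hG.
apply: (@le_trans _ _ (\sum_(1 <= r < U.+1 | P r) \sum_(1 <= j < (U * D).+1 | (r %| j)%N) F j)).
  rewrite big_nat_cond [X in _ <= X]big_nat_cond.
  apply: ler_sum => r /andP[/andP[r0 rU] _].
  rewrite -sum_dvd_mul // [X in _ <= X]big_mkcond (@big_cat_nat _ _ _ D.+1 1 (U * D).+1) //=; last first.
    by rewrite ltnS leq_pmull //; apply: (leq_trans r0); rewrite -ltnS.
  rewrite -[X in X <= _]addr0 lerD //; last first.
    by apply: sumr_ge0 => b _; case: ifP.
  rewrite big_nat_cond [X in _ <= X]big_nat_cond.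
  by apply: ler_sum => d /andP[/andP[d0 dD] _]; rewrite leq_mul.
rewrite (exchange_big_dep predT) //= mulr_sumr.
rewrite big_nat_cond [X in _ <= X]big_nat_cond.
apply: ler_sum => j /andP[/andP[j0 jUD] _].
have jN : (0 < j <= N)%N by rewrite j0 (leq_trans _ UDN).
have := ler_wpM2r (F0 j) (hG j jN); apply: le_trans.
by rewrite mulr_suml; apply: ler_sum => r _; rewrite mul1r.
Qed.

End Multiplicity.

(** * Bilinear sums *)

Section TypeII.
Variable R : realType.
Variables (alpha : R) (N U V : nat) (P : pred nat) (g : nat -> nat -> R).
Hypotheses (U0 : (0 < U)%N) (V0 : (0 < V)%N).
(* [g] need not factor: monotonicity in [m] replaces separation of variables. *)
Hypothesis g01 : forall c m, (V < c)%N -> (V < m)%N -> 0 <= g c m <= 1.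
Hypothesis g_decr : forall c m, (V < c)%N -> (V < m)%N -> g c m.+1 <= g c m.

Let inner (r m : nat) : R[i] :=
  \sum_(V.+1 <= c < N.+1 | (r * m * c <= N)%N) (g c m)%:C * e (alpha * (r * m * c)%:R).

Let coef r m c : R := if (r * m * c <= N)%N then g c m else 0.

(** Since [m > V], only [c <= N / V] contribute. *)
Lemma inner_short r m : (0 < r)%N -> (V < m)%N ->
  inner r m = \sum_(V.+1 <= c < (N %/ V).+1) (coef r m c)%:C * e (alpha * (r * m * c)%:R).
Proof.
move=> r0 Vm.
rewrite (@big_nat_widen _ _ _ V.+1 (N %/ V).+1 N.+1) ?ltnS ?leq_div // /inner.
rewrite big_mkcond [RHS]big_mkcond /=; apply: eq_bigr => c _; rewrite /coef.
case: ifP => h; last by rewrite mul0r if_same.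
rewrite ltnS leq_divRL // (leq_trans _ h) //.
by rewrite mulnC leq_mul2r (leq_trans (ltnW Vm)) ?orbT // leq_pmull.
Qed.

Lemma inner_sqr r m : (0 < r)%N -> (V < m)%N ->
  (normc (inner r m) ^+ 2)%:C =
  \sum_(V.+1 <= c < (N %/ V).+1) \sum_(V.+1 <= d < (N %/ V).+1)
    (coef r m c * coef r m d)%:C * e (m%:R * (alpha * r%:R * (c%:R - d%:R))).
Proof.
move=> r0 Vm; rewrite normc_sqr inner_short // conjc_sum mulr_suml.
apply: eq_bigr => c _; rewrite mulr_sumr; apply: eq_bigr => d _.
rewrite conjcM conjc_real -eN mulrACA -rmorphM /= -eD; congr (_ * e _).
by rewrite !natrM; ring.
Qed.

Let majorant (c d : nat) : R := \sum_(1 <= r < U.+1 | P r)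
  6 * (N%:R / (maxn c d)%:R) *
  kern (N%:R / (r * maxn c d)%:R) (alpha * r%:R * (c%:R - d%:R)).

(** The weight [m] increases while [g c m * g d m] decreases, so the sum is
    reduced to a geometric one by two summations by parts. *)
Lemma weighted_kern r c d x : (0 < r)%N -> (V < c)%N -> (V < d)%N ->
  normc (\sum_(V.+1 <= m < N.+1) (m%:R * (coef r m c * coef r m d))%:C * e (m%:R * x)) <=
  6 * (N%:R / (r * maxn c d)%:R) * kern (N%:R / (r * maxn c d)%:R) x.
Proof.
move=> r0 Vc Vd; set D := (r * maxn c d)%N.
have D0 : (0 < D)%N by rewrite muln_gt0 r0 leq_max (leq_ltn_trans _ Vc).
have -> : \sum_(V.+1 <= m < N.+1) (m%:R * (coef r m c * coef r m d))%:C * e (m%:R * x) =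
   \sum_(V.+1 <= m < (N %/ D).+1) m%:R%:C * ((g c m * g d m)%:C * e (m%:R * x)).
  rewrite -sum_le_div // [RHS]big_mkcond; apply: eq_bigr => m _.
  rewrite /coef.
  have -> : (D * m <= N)%N = (r * m * c <= N)%N && (r * m * d <= N)%N.
    rewrite /D -mulnA [(maxn _ _ * _)%N]mulnC mulnA maxnMr geq_max.
    by [].
  case: ifP => _ /=; last by rewrite mul0r mulr0 mul0r.
  case: ifP => _; last by rewrite !mulr0 mul0r.
  by rewrite rmorphM /= -mulrA.
set B := kern _ _; have X0 : 0 <= N%:R / D%:R :> R by rewrite divr_ge0.
have B0 : 0 <= B by rewrite kern_ge0.
have -> : 6 * (N%:R / D%:R) * B = 2 * (N%:R / D%:R) * (3 * B) by ring.
apply: (abel_incr (w := fun m => m%:R)).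
- by rewrite mulr_ge0.
- move=> m /andP[_ mD]; rewrite ler0n (le_trans _ (ratio_le _ _ _)) //.
  by rewrite ler_nat -ltnS.
- by move=> m _ _; rewrite ler_nat.
- exact: X0.
move=> t ht; rewrite -[3 * B]mul1r; apply: (abel_decr (w := fun m => g c m * g d m)).
- by rewrite mulr_ge0.
- move=> m /andP[Vm _]; have /andP[g1 _] := g01 Vc Vm; have /andP[g2 _] := g01 Vd Vm.
  exact: mulr_ge0.
- move=> m Vm _; have /andP[g1 _] := g01 Vc (ltnW Vm : (V < m.+1)%N).
  have /andP[g2 _] := g01 Vd (ltnW Vm : (V < m.+1)%N).
  by apply: ler_pM => //; apply: g_decr.
- move=> _; have /andP[g1 g2] := g01 Vc (ltnSn V); have /andP[g3 g4] := g01 Vd (ltnSn V).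
  by rewrite -[X in _ <= X]mulr1; apply: ler_pM.
- exact: ler01.
by move=> t' ht'; apply: linear_kern => //; apply: leq_trans ht.
Qed.

(** Open the square and sum over [m] first. *)
Lemma second_moment_le :
  \sum_(1 <= r < U.+1 | P r) \sum_(V.+1 <= m < N.+1)
    (r * m)%:R * normc (inner r m) ^+ 2 <=
  \sum_(V.+1 <= c < (N %/ V).+1) \sum_(V.+1 <= d < (N %/ V).+1) majorant c d.
Proof.
set S := \sum_(1 <= _ < _ | _) _.
have S0 : 0 <= S by do 2!apply: sumr_ge0 => ? _; rewrite mulr_ge0 // exprn_ge0 // normc_ge0.
have SC : S%:C = \sum_(V.+1 <= c < (N %/ V).+1) \sum_(V.+1 <= d < (N %/ V).+1)
   \sum_(1 <= r < U.+1 | P r) r%:R%:C * \sum_(V.+1 <= m < N.+1)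
    (m%:R * (coef r m c * coef r m d))%:C * e (m%:R * (alpha * r%:R * (c%:R - d%:R))).
  under [RHS]eq_bigr do rewrite exchange_big /=.
  rewrite [RHS]exchange_big /= /S rmorph_sum /=.
  rewrite big_nat_cond [RHS]big_nat_cond.
  apply: eq_bigr => r /andP[/andP[r0 _] _]; rewrite rmorph_sum /=.
  under [RHS]eq_bigr do rewrite -mulr_sumr exchange_big /=.
  rewrite -mulr_sumr [X in _ = _ * X]exchange_big /= mulr_sumr.
  rewrite big_nat_cond [RHS]big_nat_cond.
  apply: eq_bigr => m /andP[/andP[Vm _] _].
  rewrite rmorphM /= inner_sqr // natrM rmorphM /= -mulrA; congr (_ * _).
  rewrite mulr_sumr; apply: eq_bigr => c _; rewrite mulr_sumr.
  by apply: eq_bigr => d _; rewrite [in RHS]rmorphM /= -[RHS]mulrA.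
rewrite -[S]ger0_norm // -normc_real SC.
apply: le_trans (le_normc_sum _ _ _) _; rewrite big_nat_cond [X in _ <= X]big_nat_cond.
apply: ler_sum => c /andP[/andP[Vc _] _].
apply: le_trans (le_normc_sum _ _ _) _; rewrite big_nat_cond [X in _ <= X]big_nat_cond.
apply: ler_sum => d /andP[/andP[Vd _] _].
apply: le_trans (le_normc_sum _ _ _) _; rewrite /majorant.
rewrite big_nat_cond [X in _ <= X]big_nat_cond.
apply: ler_sum => r /andP[/andP[r0 _] _].
rewrite normcM normc_real ger0_norm ?ler0n //.
have R0 : r%:R != 0 :> R by rewrite pnatr_eq0 -lt0n.
have -> : N%:R / (maxn c d)%:R = r%:R * (N%:R / (r * maxn c d)%:R) :> R.
  by rewrite natrM invfM mulrCA [r%:R * _]mulrA mulfV // mul1r.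
set K := kern _ _; rewrite [6 * _]mulrCA -[_ * K]mulrA ler_wpM2l //.
exact: weighted_kern.
Qed.

Lemma majorantC c d : majorant c d = majorant d c.
Proof.
apply: eq_bigr => r _; rewrite maxnC; congr (_ * _).
by rewrite -kernN -mulrN opprB.
Qed.

Lemma majorant_ge0 c d : 0 <= majorant c d.
Proof.
apply: sumr_ge0 => r _; apply: mulr_ge0; first by rewrite mulr_ge0 // divr_ge0.
by rewrite kern_ge0 // divr_ge0.
Qed.

Lemma sum_symmetric (s : seq nat) (T : nat -> nat -> R) :
  (forall c d, T c d = T d c) -> (forall c d, 0 <= T c d) ->
  \sum_(c <- s) \sum_(d <- s) T c d <= 2 * \sum_(c <- s) \sum_(d <- s | (d <= c)%N) T c d.
Proof.
move=> TC T0.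
rewrite mulr_natl mulr2n [X in _ <= _ + X](exchange_big_dep predT) //= -big_split /=.
apply: ler_sum => c _; rewrite [X in _ <= X + _]big_mkcond [X in _ <= _ + X]big_mkcond /=.
rewrite -big_split /=; apply: ler_sum => d _.
have := T0 c d; have := T0 d c; rewrite [T d c]TC.
by case: (leqP d c) => h; case: (leqP c d) => h'; try lra; move: h h'; lia.
Qed.

Variables (a : int) (q : nat) (G : R).
Hypotheses (q0 : (0 < q)%N) (aq : coprimez a q%:Z).
Hypothesis approx : `|alpha - a%:~R / q%:R| <= 1 / q%:R ^+ 2.
Hypotheses (N4 : (4 <= N)%N) (qN : (q <= N)%N) (UV : (U <= V)%N).
Hypothesis multP :
  forall j, (0 < j <= N)%N -> \sum_(1 <= r < U.+1 | P r && (r %| j)%N) 1 <= G.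
Hypothesis G1 : 1 <= G.

Let L : R := ln N%:R.

Lemma harm_le_ln k : (k <= N)%N -> harm R k <= 2 * L.
Proof.
move=> kN; apply: le_trans (harm_mono R kN) _.
apply: le_trans (harm_ln R _) _; first by apply: leq_trans N4.
by have := ln_nat_ge1 R N4; rewrite -/L; lra.
Qed.

(** The diagonal term [d = c] gives the first summand. For the others put
    [h = c - d]: since [h < c], the kernel may be enlarged from [N / (r * c)] to
    [N / (r * h)], after which it only depends on [j = r * h]. *)
Lemma majorant_row c : (V < c)%N -> (c <= N %/ V)%N ->
  \sum_(V.+1 <= d < (N %/ V).+1 | (d <= c)%N) majorant c d <=
  6 * (N%:R / c%:R) *
   (2 * L * (N%:R / c%:R) + G * (48 * L * (N%:R / q%:R + (U * c)%:R + q%:R))).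
Proof.
move=> Vc cNV; have c0 : (0 < c)%N by apply: leq_ltn_trans Vc.
have X0 : 0 <= 6 * (N%:R / c%:R) :> R by rewrite mulr_ge0 // divr_ge0.
have UcN : (U * c <= N)%N.
  by apply: leq_trans (leq_trunc_div N V); rewrite mulnC leq_mul.
have -> : \sum_(V.+1 <= d < (N %/ V).+1 | (d <= c)%N) majorant c d =
  6 * (N%:R / c%:R) * \sum_(1 <= r < U.+1 | P r) \sum_(V.+1 <= d < c.+1)
    kern (N%:R / (r * c)%:R) (alpha * (r * (c - d))%:R).
  rewrite mulr_sumr.
  have -> : \sum_(V.+1 <= d < (N %/ V).+1 | (d <= c)%N) majorant c d =
            \sum_(V.+1 <= d < c.+1) majorant c d.
    by rewrite [RHS](@big_nat_widen _ _ _ V.+1 c.+1 (N %/ V).+1).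
  rewrite /majorant exchange_big /=; apply: eq_bigr => r _.
  rewrite mulr_sumr big_nat_cond [RHS]big_nat_cond.
  apply: eq_bigr => d /andP[/andP[_ dc] _].
  rewrite ltnS in dc; rewrite (maxn_idPl dc); congr (_ * kern _ _).
  by rewrite natrM natrB // mulrA.
rewrite ler_wpM2l //.
apply: (@le_trans _ _ (\sum_(1 <= r < U.+1 | P r)
  (N%:R / c%:R / r%:R +
   \sum_(1 <= h < c.-1.+1) kern (N%:R / (r * h)%:R) (alpha * (r * h)%:R)))).
  rewrite big_nat_cond [X in _ <= X]big_nat_cond.
  apply: ler_sum => r /andP[/andP[r0 _] _].
  have K0 h : 0 <= kern (N%:R / (r * c)%:R) (alpha * (r * h)%:R).
    by rewrite kern_ge0 // divr_ge0.
  rewrite big_nat_rev /=.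
  rewrite (eq_big_nat _ _ (F2 := fun i => kern (N%:R / (r * c)%:R) (alpha * (r * (i - V.+1))%:R))).
    rewrite -{1}[V.+1]add0n big_addn.
    rewrite subSS (_ : \sum_(0 <= i < c - V) _ =
      \sum_(0 <= i < c - V) kern (N%:R / (r * c)%:R) (alpha * (r * i)%:R)); last first.
      by apply: eq_bigr => i _; rewrite addnK.
    apply: (@le_trans _ _ (\sum_(0 <= h < c) kern (N%:R / (r * c)%:R) (alpha * (r * h)%:R))).
      by rewrite [X in _ <= X](@big_cat_nat _ _ _ (c - V)) ?leq_subr //= lerDl sumr_ge0.
    rewrite [X in X <= _]big_ltn // prednK // lerD //.
      apply: le_trans (kern_le _ _) _; first by rewrite divr_ge0.
      by rewrite natrM invfM mulrA mulrAC.
    rewrite big_nat_cond [X in _ <= X]big_nat_cond.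
    apply: ler_sum => h /andP[/andP[h0 hc] _].
    apply: kern_mono; first by rewrite divr_ge0.
    rewrite ler_wpM2l // lef_pV2 ?posrE ?ltr0n ?muln_gt0 ?r0 // ler_nat leq_mul2l.
    by rewrite ltnW // orbT.
  move=> i /andP[Vi ic]; congr (kern _ (_ * (_ * _)%:R)).
  by move: Vi ic; clear; lia.
rewrite big_split /= lerD //.
  rewrite -mulr_sumr mulrC ler_wpM2r ?divr_ge0 //.
  apply: (@le_trans _ _ (harm R U)).
    by rewrite /harm [X in _ <= X](bigID P) /= lerDl sumr_ge0.
  by apply: harm_le_ln; apply: leq_trans UcN; rewrite leq_pmulr.
have UcN' : (U * c.-1 <= N)%N by apply: leq_trans UcN; rewrite leq_mul2l leq_pred orbT.
have F0 n : 0 <= kern (N%:R / n%:R) (alpha * n%:R) by rewrite kern_ge0 // divr_ge0.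
apply: le_trans (sum_multiplicity F0 UcN' multP) _.
rewrite ler_wpM2l ?(le_trans ler01 G1) //.
apply: le_trans (kern_sum q0 aq approx N4 qN UcN') _.
rewrite ler_wpM2l ?mulr_ge0 // ?(le_trans ler01 (ln_nat_ge1 R N4)) //.
by rewrite lerD2r lerD2l ler_nat leq_mul2l leq_pred orbT.
Qed.

(** Compare [1 / c ^ 2] with [1 / (c - 1) - 1 / c]. *)
Lemma sum_inv_sq m n : (0 < m)%N ->
  \sum_(m.+1 <= c < n) (c%:R ^+ 2)^-1 <= m%:R^-1 :> R.
Proof.
move=> m0; have M0 : 0 <= m%:R^-1 :> R by rewrite invr_ge0.
have [nm|mn] := leqP n m.+1; first by rewrite big_geq.
suff H k : \sum_(m.+1 <= c < m.+1 + k) (c%:R ^+ 2)^-1 <= m%:R^-1 - (m + k)%:R^-1 :> R.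
  rewrite -(subnKC (ltnW mn)); apply: le_trans (H _) _.
  by rewrite gerBl invr_ge0.
elim: k => [|k IH]; first by rewrite addn0 big_geq // addn0 subrr.
rewrite addnS big_nat_recr ?leq_addr //=.
have h : (((m.+1 + k)%:R ^+ 2)^-1 : R) <= (m + k)%:R^-1 - (m + k.+1)%:R^-1.
  rewrite addnS addSn; set j := (m + k)%N.
  have j0 : 0 < j%:R :> R by rewrite ltr0n addn_gt0 m0.
  have -> : j%:R^-1 - j.+1%:R^-1 = (j%:R * j.+1%:R)^-1 :> R.
    have jn0 : j%:R != 0 :> R by rewrite gt_eqF.
    have j1 : j%:R + 1 != 0 :> R by rewrite natr1.
    by rewrite -natr1; field; rewrite j1 jn0.
  rewrite lef_pV2 ?posrE ?mulr_gt0 ?exprn_gt0 // expr2 ler_wpM2r //.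
  by rewrite ler_nat.
by apply: le_trans (lerD IH h) _; rewrite addrA subrK.
Qed.

(** The sum over [c] of [majorant_row]; the three terms of the parenthesis come
    from the three terms of [kern_sum], and the diagonal is absorbed by the
    last one. *)
Lemma second_moment :
  \sum_(1 <= r < U.+1 | P r) \sum_(V.+1 <= m < N.+1)
    (r * m)%:R * normc (inner r m) ^+ 2 <=
  1152 * G * L ^+ 2 * N%:R * (N%:R / q%:R + q%:R + N%:R * (U%:R / V%:R)).
Proof.
apply: le_trans second_moment_le _.
apply: le_trans (sum_symmetric _ majorantC majorant_ge0) _.
have L1 : 1 <= L by apply: ln_nat_ge1.
set A : R := N%:R / q%:R + q%:R.
have A0 : 0 <= A by rewrite addr_ge0 // divr_ge0.
have NN : 0 <= N%:R :> R by [].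
set W : R := N%:R * (U%:R / V%:R).
have W0 : 0 <= W by rewrite mulr_ge0 // divr_ge0.
apply: (@le_trans _ _ (2 * \sum_(V.+1 <= c < (N %/ V).+1)
   (12 * L * N%:R ^+ 2 * (c%:R ^+ 2)^-1 +
   (288 * G * L * N%:R * A * c%:R^-1 + 288 * G * L * N%:R * U%:R)))).
  rewrite ler_wpM2l // big_nat_cond [X in _ <= X]big_nat_cond.
  apply: ler_sum => c /andP[/andP[Vc cN] _].
  apply: le_trans (majorant_row Vc _) _; first by rewrite -ltnS.
  have C0 : c%:R != 0 :> R by rewrite pnatr_eq0 -lt0n (leq_ltn_trans _ Vc).
  rewrite natrM le_eqVlt; apply/orP; left; apply/eqP; rewrite /A.
  by field; rewrite C0 pnatr_eq0 -lt0n q0.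
rewrite !big_split /= -!mulr_sumr sumr_const_nat subSS.
have h1 : \sum_(V.+1 <= i < (N %/ V).+1) (i%:R ^+ 2)^-1 <= V%:R^-1 :> R by apply: sum_inv_sq.
have h2 : \sum_(V.+1 <= i < (N %/ V).+1) i%:R^-1 <= 2 * L.
  have VN : (N %/ V <= N)%N by apply: leq_div.
  apply: le_trans (harm_le_ln VN); rewrite /harm.
  have [h|h] := leqP (N %/ V) V; first by rewrite big_geq // sumr_ge0 // => i _; rewrite invr_ge0.
  rewrite [X in _ <= X](@big_cat_nat _ _ _ V.+1) //=; last by rewrite ltnS ltnW.
  by rewrite lerDr sumr_ge0 // => i _; rewrite invr_ge0.
have G0 : 0 <= G by apply: le_trans G1.
have L0 : 0 <= L by apply: le_trans L1.
have GLN : 0 <= 288 * G * L * N%:R.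
  by apply: mulr_ge0 NN; apply: mulr_ge0 L0; apply: mulr_ge0 G0; apply: ler0n.
have h3 : (288 * G * L * N%:R * U%:R) *+ (N %/ V - V) <= 288 * G * L * N%:R * W.
  rewrite -[X in X <= _]mulr_natr -[X in X <= _]mulrA; apply: (ler_wpM2l GLN).
  rewrite /W mulrCA ler_wpM2l //.
  by apply: le_trans (ratio_le _ _ _); rewrite ler_nat leq_subr.
have h4 : 12 * L * N%:R ^+ 2 * (\sum_(V.+1 <= i < (N %/ V).+1) (i%:R ^+ 2)^-1) <=
    12 * L * N%:R ^+ 2 * V%:R^-1.
  by rewrite ler_wpM2l // !mulr_ge0.
have h5 : 288 * G * L * N%:R * A * (\sum_(V.+1 <= i < (N %/ V).+1) i%:R^-1) <=
     288 * G * L * N%:R * A * (2 * L).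
  by apply: (ler_wpM2l _ h2); apply: mulr_ge0 A0.
have h6 : 12 * L * N%:R ^+ 2 * V%:R^-1 <= 12 * L * (N%:R * W).
  rewrite -mulrA ler_wpM2l ?mulr_ge0 // expr2 -mulrA ler_wpM2l // /W.
  rewrite ler_wpM2l // ler_peMl ?invr_ge0 //.
  by rewrite (ler_nat _ 1).
have LG : L <= G * L ^+ 2 by rewrite expr2 mulrA ler_peMl // mulr_ege1.
have LG' : G * L <= G * L ^+ 2 by rewrite ler_wpM2l // expr2 ler_peMl.
have t0 : 0 <= N%:R * W by rewrite mulr_ge0.
have h7 : L * (N%:R * W) <= G * L ^+ 2 * (N%:R * W) by rewrite ler_wpM2r.
have h8 : G * L * (N%:R * W) <= G * L ^+ 2 * (N%:R * W) by rewrite ler_wpM2r.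
have h9 : 0 <= G * L ^+ 2 * (N%:R * W) by rewrite !mulr_ge0 // exprn_ge0.
have e1 : 288 * G * L * N%:R * A * (2 * L) = 576 * (G * L ^+ 2 * (N%:R * A)) by ring.
have e2 : 288 * G * L * N%:R * W = 288 * (G * L * (N%:R * W)) by ring.
have e3 : 12 * L * (N%:R * W) = 12 * (L * (N%:R * W)) by ring.
have -> : 1152 * G * L ^+ 2 * N%:R * (A + W) =
   1152 * (G * L ^+ 2 * (N%:R * A)) + 1152 * (G * L ^+ 2 * (N%:R * W)) by ring.
rewrite e1 in h5; rewrite e2 in h3; rewrite e3 in h6.
by have h10 := le_trans h4 h6; lra.
Qed.

(** Cauchy's inequality with the weight [r * m], in the form of the
    arithmetic-geometric mean inequality applied to every term. *)
Lemma typeII_bound (A : nat -> R) (Q : R) : 0 < Q ->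
  \sum_(1 <= r < U.+1 | P r) \sum_(V.+1 <= m < N.+1) A m ^+ 2 / (r * m)%:R <= Q ->
  normc (\sum_(1 <= r < U.+1 | P r) \sum_(V.+1 <= m < N.+1) (A m)%:C * inner r m) ^+ 2 <=
  Q * (1152 * G * L ^+ 2 * N%:R * (N%:R / q%:R + q%:R + N%:R * (U%:R / V%:R))).
Proof.
move=> Q0 hQ; set Y := 1152 * _ * _ * _ * _.
have hY := second_moment; rewrite -/Y in hY.
set B := normc _; have B0 : 0 <= B by apply: normc_ge0.
have Y0 : 0 <= Y.
  by apply: le_trans hY; do 2!apply: sumr_ge0 => ? _; rewrite mulr_ge0 // exprn_ge0 // normc_ge0.
have key t : 0 < t -> 2 * B <= t * Q + Y / t.
  move=> t0.
  have h : 2 * B <= t * (\sum_(1 <= r < U.+1 | P r) \sum_(V.+1 <= m < N.+1) A m ^+ 2 / (r * m)%:R)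
    + (\sum_(1 <= r < U.+1 | P r) \sum_(V.+1 <= m < N.+1)
        (r * m)%:R * normc (inner r m) ^+ 2) / t.
    apply: (@le_trans _ _ (2 * \sum_(1 <= r < U.+1 | P r) \sum_(V.+1 <= m < N.+1)
        normc ((A m)%:C * inner r m))).
      rewrite ler_wpM2l // /B; apply: le_trans (le_normc_sum _ _ _) _.
      by apply: ler_sum => r _; apply: le_normc_sum.
    rewrite mulr_sumr mulr_sumr mulr_suml -big_split /=.
    rewrite big_nat_cond [X in _ <= X]big_nat_cond.
    apply: ler_sum => r /andP[/andP[r0 _] _].
    rewrite mulr_sumr mulr_sumr mulr_suml -big_split /=.
    rewrite big_nat_cond [X in _ <= X]big_nat_cond.
    apply: ler_sum => m /andP[/andP[m0 _] _].
    rewrite normcM normc_real -[A m ^+ 2]real_normK ?num_real //.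
    move: `|A m| (normc _) => x y.
    have w0 : 0 < (r * m)%:R :> R by rewrite ltr0n muln_gt0 r0 (leq_ltn_trans _ m0).
    move: w0; move: ((r * m)%:R : R) => w w0.
    rewrite -subr_ge0.
    have -> : t * (x ^+ 2 / w) + w * y ^+ 2 / t - 2 * (x * y) = (t * x - w * y) ^+ 2 / (t * w).
      by field; rewrite (gt_eqF w0) (gt_eqF t0).
    by rewrite divr_ge0 ?sqr_ge0 // ltW // mulr_gt0.
  apply: le_trans h _; apply: lerD; first by rewrite ler_wpM2l // ltW.
  by rewrite ler_wpM2r // invr_ge0 ltW.
move: B0; rewrite le_eqVlt => /predU1P[<-|B0].
  by rewrite expr0n mulr_ge0 // ltW.
have := key (B / Q) (divr_gt0 B0 Q0).
rewrite mulfVK ?gt_eqF // invf_div => h.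
have h1 : B <= Y * (Q / B) by lra.
have := ler_wpM2l (ltW B0) h1.
have -> : B * (Y * (Q / B)) = Q * Y.
  by rewrite mulrCA [B * (Q / B)]mulrC mulfVK ?gt_eqF // mulrC.
by rewrite expr2.
Qed.


End TypeII.

(** * Sums over pairs of primes *)

Lemma widen_hyperbola (A : nmodType) (s M N : nat) (F : nat -> nat -> A) :
  (0 < s)%N -> (M <= N)%N ->
  \sum_(s <= c < M.+1) \sum_(s <= m < M.+1 | (c * m <= M)%N) F c m =
  \sum_(s <= c < N.+1) \sum_(s <= m < N.+1 | (c * m <= M)%N) F c m.
Proof.
move=> s0 MN.
transitivity (\sum_(s <= c < M.+1) \sum_(s <= m < N.+1 | (c * m <= M)%N) F c m).
  rewrite big_nat_cond [RHS]big_nat_cond; apply: eq_bigr => c /andP[/andP[sc _] _].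
  rewrite (@big_nat_widen _ _ _ s M.+1 N.+1) ?ltnS //=; apply: eq_bigl => m.
  case: (boolP (c * m <= M)%N) => //= h; rewrite ltnS (leq_trans _ h) //.
  by rewrite leq_pmull // (leq_trans s0).
rewrite [LHS](@big_nat_widen _ _ _ s M.+1 N.+1) ?ltnS // big_mkcond /=.
rewrite big_nat_cond [RHS]big_nat_cond; apply: eq_bigr => c _.
rewrite ltnS; case: leqP => // Mc.
rewrite big_nat_cond big_pred0 // => m; apply/negbTE/negP => /andP[/andP[sm _]].
rewrite leqNgt (leq_trans Mc) // leq_pmulr //; exact: leq_trans sm.
Qed.

Section PrimePairs.
Variable R : realType.
Variables (alpha : R) (a : int) (q N U : nat).
Hypotheses (q0 : (0 < q)%N) (aq : coprimez a q%:Z).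
Hypothesis approx : `|alpha - a%:~R / q%:R| <= 1 / q%:R ^+ 2.
Hypotheses (N4 : (4 <= N)%N) (qN : (q <= N)%N).
Hypotheses (U0 : (0 < U)%N) (UN : (U ^ 6 <= N)%N) (NU : (N < U.+1 ^ 6)%N).

Let L : R := ln N%:R.
(* With [U] about [N ^ (1/6)], this choice makes the linear range [U * V ^ 2]
   at most [N ^ (5/6)] and the bilinear loss [U / V] equal to [1 / U]. *)
Let V := (U * U)%N.
Let W : R := Num.sqrt (N%:R * (N%:R / q%:R + q%:R + N%:R / U%:R)).

Let L1 : 1 <= L. Proof. exact: ln_nat_ge1. Qed.
Let L0 : 0 <= L. Proof. exact: le_trans ler01 L1. Qed.

Let powU k : (k <= 6)%N -> (U ^ k <= N)%N.
Proof. by move=> k6; apply: leq_trans UN; rewrite leq_pexp2l. Qed.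

Let E0 : 0 <= N%:R * (N%:R / q%:R + q%:R + N%:R / U%:R) :> R.
Proof. by rewrite mulr_ge0 // !addr_ge0 // divr_ge0. Qed.

Lemma le_W (x : R) : x ^+ 2 <= N%:R * (N%:R / q%:R + q%:R + N%:R / U%:R) -> x <= W.
Proof.
move=> h; rewrite /W; apply: le_trans (ler_norm x) _.
by rewrite -sqrtr_sqr ler_wsqrtr.
Qed.

Lemma le_W_mul (x C : R) : 0 <= C ->
  x ^+ 2 <= C ^+ 2 * (N%:R * (N%:R / q%:R + q%:R + N%:R / U%:R)) -> x <= C * W.
Proof.
move=> C0 h; apply: le_trans (ler_norm x) _.
rewrite -(ger0_norm C0) -[`|C|]sqrtr_sqr /W -sqrtrM ?sqr_ge0 // -sqrtr_sqr.
by rewrite ler_wsqrtr.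
Qed.

Let Q0 : 0 < q%:R :> R. Proof. by rewrite ltr0n. Qed.
Let u0 : 0 < U%:R :> R. Proof. by rewrite ltr0n. Qed.
Let n0 : 0 <= N%:R :> R. Proof. by []. Qed.
Let qn : q%:R <= N%:R :> R. Proof. by rewrite ler_nat. Qed.

Let three_terms : 
  [/\ 0 <= N%:R * (N%:R / q%:R) :> R, 0 <= N%:R * q%:R :> R & 0 <= N%:R * (N%:R / U%:R) :> R].
Proof. by rewrite !mulr_ge0 ?divr_ge0. Qed.

Lemma Nq_le_W : N%:R / q%:R <= W.
Proof.
apply: le_W; rewrite !mulrDr; have [h1 h2 h3] := three_terms.
suff : (N%:R / q%:R) ^+ 2 <= N%:R * (N%:R / q%:R) :> R by lra.
rewrite expr2 ler_wpM2r ?divr_ge0 // ler_pdivrMr // ler_peMr // ler1n //.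
Qed.

Lemma q_le_W : q%:R <= W.
Proof.
apply: le_W; rewrite !mulrDr; have [h1 h2 h3] := three_terms.
suff : q%:R ^+ 2 <= N%:R * q%:R :> R by lra.
by rewrite expr2 ler_wpM2r.
Qed.

Lemma U_le_W k : (k <= 5)%N -> (U ^ k)%:R <= W.
Proof.
move=> k5; apply: le_W; rewrite !mulrDr; have [h1 h2 h3] := three_terms.
suff : (U ^ k)%:R ^+ 2 <= N%:R * (N%:R / U%:R) :> R by lra.
rewrite mulrA ler_pdivlMr // -natrX -!natrM ler_nat -expnM -expnSr.
apply: leq_trans (leq_mul UN UN); rewrite -expnD leq_pexp2l //.
by move: k5; clear; lia.
Qed.

Let G : R := 2 * L.

Let G1 : 1 <= G. Proof. rewrite /G; have := L1; lra. Qed.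

Let multP j : (0 < j <= N)%N -> \sum_(1 <= r < U.+1 | prime r && (r %| j)%N) 1 <= G.
Proof. by case/andP=> j0 jN; apply: prime_divisors_le. Qed.

Let VVU : (U * (V * V) = U ^ 5)%N. Proof. by rewrite /V !expnS muln1 !mulnA. Qed.

(** The relevant range of [j = r * d] is [U * V ^ 2 = U ^ 5]. *)
Lemma sum_typeI :
  \sum_(1 <= r < U.+1 | prime r)
    9 * \sum_(1 <= d < (V * V).+1) kern ((N %/ r)%:R / d%:R) (alpha * r%:R * d%:R) <=
  2592 * L ^+ 2 * W.
Proof.
rewrite -mulr_sumr.
pose F n := kern (N%:R / n%:R) (alpha * n%:R).
have F0 n : 0 <= F n by rewrite kern_ge0 // divr_ge0.
have UVN : (U * (V * V) <= N)%N by rewrite VVU powU.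
have h1 : \sum_(1 <= r < U.+1 | prime r)
    \sum_(1 <= d < (V * V).+1) kern ((N %/ r)%:R / d%:R) (alpha * r%:R * d%:R) <=
   G * \sum_(1 <= j < (U * (V * V)).+1) F j.
  apply: le_trans (sum_multiplicity F0 UVN multP).
  apply: ler_sum => r _; apply: ler_sum => d _.
  rewrite /F natrM -mulrA; apply: kern_mono; first by rewrite divr_ge0.
  by rewrite invfM mulrA ler_wpM2r ?invr_ge0 // ratio_le.
have h2 := kern_sum q0 aq approx N4 qN UVN.
rewrite -/L in h2.
have h3 : N%:R / q%:R + (U * (V * V))%:R + q%:R <= 3 * W.
  by have := Nq_le_W; have := q_le_W; rewrite VVU; have := U_le_W (leqnn 5); lra.
have h4 : \sum_(1 <= j < (U * (V * V)).+1) F j <= 48 * L * (3 * W).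
  by apply: le_trans h2 _; rewrite ler_wpM2l // mulr_ge0.
have G0 : 0 <= G by apply: le_trans G1.
have h5 := le_trans h1 (ler_wpM2l G0 h4).
apply: le_trans (ler_wpM2l (ler0n R 9) h5) _.
by rewrite /G le_eqVlt; apply/orP; left; apply/eqP; ring.
Qed.

Let VN r : (0 < r <= U)%N -> (V <= N %/ r)%N.
Proof.
case/andP=> r0 rU; rewrite leq_divRL //; apply: leq_trans (@powU 3 isT).
by rewrite /V (_ : U ^ 3 = U * U * U)%N ?leq_mul // !expnS muln1 mulnA.
Qed.

Let g (c m : nat) : R := mangoldt R c / ln (c * m)%:R.

Let V0 : (0 < V)%N. Proof. by rewrite /V muln_gt0 U0. Qed.

Lemma mangoldt_ln_le1 c n : (1 < c)%N -> (c <= n)%N ->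
  0 <= (mangoldt R c / ln n%:R : R) <= 1.
Proof.
move=> c1 cn; rewrite mulr_ge0 ?mangoldt_ge0 ?inv_ln_ge0 //=.
have ln0 : 0 < ln n%:R :> R by rewrite ln_gt0 // ltr1n (leq_trans c1).
rewrite ler_pdivrMr // mul1r (le_trans (mangoldt_le _ _)) //.
have c0 := ltnW c1; have n0' := leq_trans c0 cn.
by rewrite ler_ln ?posrE ?ltr0n ?ler_nat.
Qed.

Let g01 c m : (V < c)%N -> (V < m)%N -> 0 <= g c m <= 1.
Proof.
move=> Vc Vm; apply: mangoldt_ln_le1; first exact: leq_ltn_trans Vc.
by rewrite leq_pmulr // (leq_ltn_trans _ Vm).
Qed.

Let g_decr c m : (V < c)%N -> (V < m)%N -> g c m.+1 <= g c m.
Proof.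
move=> Vc Vm; rewrite /g ler_wpM2l ?mangoldt_ge0 //.
apply: inv_ln_mono; last by rewrite leq_mul2l leqnSn orbT.
by apply: (leq_ltn_trans V0); apply: (leq_trans Vc); rewrite leq_pmulr // (leq_ltn_trans _ Vm).
Qed.

(** The truncated Moebius sums are bounded by [tau], whose mean square costs
    [ln N ^ 4]; a further logarithm comes from the sum of
    [1 / r]. *)
Lemma sum_typeII :
  normc (\sum_(1 <= r < U.+1 | prime r) \sum_(V.+1 <= m < N.+1) (trunc_moebius R V m)%:C *
    \sum_(V.+1 <= c < N.+1 | (r * m * c <= N)%N) (g c m)%:C * e (alpha * (r * m * c)%:R)) <=
  272 * L ^+ 4 * W.
Proof.
have UV : (U <= V)%N by rewrite /V leq_pmulr.
have Q1 : 0 < 32 * L ^+ 5 by rewrite mulr_gt0 // exprn_gt0 // (lt_le_trans ltr01 L1).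
have hQ : \sum_(1 <= r < U.+1 | prime r) \sum_(V.+1 <= m < N.+1)
    trunc_moebius R V m ^+ 2 / (r * m)%:R <= 32 * L ^+ 5.
  apply: (@le_trans _ _ (harm R U * harm R N ^+ 4)).
    rewrite {1}/harm mulr_suml [X in _ <= X](bigID prime) /= -[X in X <= _]addr0 lerD //; last first.
      by apply: sumr_ge0 => r _; rewrite mulr_ge0 ?invr_ge0 // exprn_ge0 // harm_ge0.
    apply: ler_sum => r _.
    have -> : \sum_(V.+1 <= m < N.+1) trunc_moebius R V m ^+ 2 / (r * m)%:R =
        r%:R^-1 * \sum_(V.+1 <= m < N.+1) trunc_moebius R V m ^+ 2 / m%:R.
      by rewrite mulr_sumr; apply: eq_bigr => m _; rewrite natrM invfM mulrCA.
    rewrite ler_wpM2l ?invr_ge0 // (le_trans _ (sum_tau_sq R N)) //.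
    rewrite [X in _ <= X](@big_cat_nat _ _ _ V.+1) //=; last first.
      by rewrite ltnS -[N]divn1 VN.
    rewrite -[X in X <= _]add0r lerD //; first by apply: sumr_ge0 => m _; rewrite divr_ge0 // sqr_ge0.
    apply: ler_sum => m _; rewrite ler_wpM2r ?invr_ge0 //.
    rewrite -[X in X <= _]real_normK ?num_real // lerXn2r ?nnegrE ?tau_ge0 //.
    by apply: trunc_moebius_le; rewrite -[N]divn1 VN.
  have h1 : harm R U <= 2 * L by apply: harm_le_ln => //; rewrite -[U]expn1 powU.
  have h2 : harm R N <= 2 * L by apply: harm_le_ln.
  apply: (@le_trans _ _ ((2 * L) * (2 * L) ^+ 4)).
    by rewrite ler_pM ?exprn_ge0 ?harm_ge0 // lerXn2r ?nnegrE ?harm_ge0 // mulr_ge0.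
  by rewrite le_eqVlt; apply/orP; left; apply/eqP; ring.
apply: le_W_mul; first by rewrite mulr_ge0 ?ler0n ?exprn_ge0 ?L0.
have := typeII_bound (P := prime) U0 V0 g01 g_decr q0 aq approx N4 qN UV multP G1 Q1 hQ.
rewrite -/L => h; apply: le_trans h _.
have -> : U%:R / V%:R = U%:R^-1 :> R.
  by rewrite /V natrM invfM mulrA mulfV ?mul1r // gt_eqF.
set E := _ + q%:R + _.
have -> : 32 * L ^+ 5 * (1152 * G * L ^+ 2 * N%:R * E) = 1152 * 64 * (L ^+ 8 * (N%:R * E)).
  by rewrite /G; ring.
have -> : (272 * L ^+ 4) ^+ 2 * (N%:R * E) = 272 * 272 * (L ^+ 8 * (N%:R * E)) by ring.
have : 0 <= L ^+ 8 * (N%:R * E) by rewrite mulr_ge0 // exprn_ge0.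
by lra.
Qed.

(** The weight [mangoldt c / ln c] is [1] at the primes; it is removed
    in [prime_mangoldt_diff]. *)
Lemma small_mangoldt :
  normc (\sum_(1 <= r < U.+1 | prime r) \sum_(V.+1 <= c < (N %/ r).+1)
     (mangoldt R c)%:C * ((ln c%:R)^-1%:C * e (alpha * r%:R * c%:R))) <= 2864 * L ^+ 4 * W.
Proof.
have W0 : 0 <= W by apply: sqrtr_ge0.
pose f r n := (ln n%:R)^-1%:C * e (alpha * r%:R * n%:R) : R[i].
pose T1 r := \sum_(1 <= b < V.+1) (moebius R b)%:C *
     \sum_(1 <= k < (N %/ r).+1 | (b * k <= N %/ r)%N) (ln k%:R)%:C * f r (b * k)%N
  - \sum_(1 <= b < V.+1) (moebius R b)%:C * \sum_(1 <= c < V.+1) (mangoldt R c)%:C *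
     \sum_(1 <= k < (N %/ r).+1 | (b * c * k <= N %/ r)%N) f r (b * c * k)%N.
pose T2 r := \sum_(V.+1 <= m < N.+1) (trunc_moebius R V m)%:C *
    \sum_(V.+1 <= c < N.+1 | (r * m * c <= N)%N) (g c m)%:C * e (alpha * (r * m * c)%:R).
have -> : \sum_(1 <= r < U.+1 | prime r) \sum_(V.+1 <= c < (N %/ r).+1)
     (mangoldt R c)%:C * ((ln c%:R)^-1%:C * e (alpha * r%:R * c%:R)) =
   \sum_(1 <= r < U.+1 | prime r) T1 r - \sum_(1 <= r < U.+1 | prime r) T2 r.
  rewrite -sumrB big_nat_cond [RHS]big_nat_cond.
  apply: eq_bigr => r /andP[/andP[r0 rU] _].
  have rU' : (0 < r <= U)%N by rewrite r0 -ltnS.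
  rewrite (vaughan (f r) V0 (VN rU')); congr (_ - _).
  under eq_bigr do rewrite mulr_sumr.
  rewrite (@widen_hyperbola _ V.+1 (N %/ r) N) ?leq_div //.
  rewrite (exchange_big_dep predT) //= /T2; apply: eq_bigr => m _.
  rewrite mulr_sumr; apply: eq_big => [c|c _].
    by rewrite leq_divRL // mulnC mulnA mulnAC.
  have -> : alpha * (r * m * c)%:R = alpha * r%:R * (c * m)%:R by rewrite !natrM; ring.
  by rewrite /f /g [in RHS]rmorphM /=; set z := e _; ring.
apply: le_trans (le_normcD _ _) _; rewrite normcN.
have h2 := sum_typeII; rewrite -/T2 in h2.
have h1 : normc (\sum_(1 <= r < U.+1 | prime r) T1 r) <= 2592 * L ^+ 2 * W.
  apply: le_trans sum_typeI; apply: le_trans (le_normc_sum _ _ _) _.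
  by apply: ler_sum => r _; apply: typeI_bound.
have h3 : 2592 * L ^+ 2 * W <= 2592 * L ^+ 4 * W.
  have h4 : L ^+ 2 <= L ^+ 4 by rewrite ler_weXn2l.
  by have h5 := ler_wpM2r W0 h4; lra.
by lra.
Qed.

(** The two sums differ at the [c <= V], and at the prime powers that are not
    prime, of which there are [O (sqrt N * ln N)]. *)
Lemma prime_mangoldt_diff r : (0 < r <= U)%N ->
  normc (\sum_(1 <= c < N.+1 | prime c && (r * c <= N)%N) e (alpha * (r * c)%:R)
   - \sum_(V.+1 <= c < (N %/ r).+1)
     (mangoldt R c)%:C * ((ln c%:R)^-1%:C * e (alpha * r%:R * c%:R))) <=
  V%:R + 16 * (U ^ 3)%:R * L.
Proof.
move=> rU; have /andP[r0 _] := rU.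
have -> : \sum_(1 <= c < N.+1 | prime c && (r * c <= N)%N) e (alpha * (r * c)%:R) =
   \sum_(1 <= c < (N %/ r).+1) (prime c)%:R%:C * e (alpha * r%:R * c%:R) :> R[i].
  rewrite -sum_le_div // big_mkcond [RHS]big_mkcond; apply: eq_bigr => c _.
  rewrite natrM mulrA; case: (prime c) => /=; last by rewrite mul0r if_same.
  by rewrite mul1r.
rewrite (@big_cat_nat _ _ _ V.+1) //=; last by rewrite ltnS VN.
rewrite -addrA -sumrB; apply: le_trans (le_normcD _ _) _; apply: lerD.
  apply: le_trans (le_normc_sum _ _ _) _.
  apply: (@le_trans _ _ (\sum_(1 <= c < V.+1) 1)); last by rewrite sumr_const_nat subn1.
  apply: ler_sum => c _; rewrite normcM normc_e mulr1 normc_real.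
  by case: (prime c); rewrite ?normr0 ?normr1.
apply: le_trans (le_normc_sum _ _ _) _.
have cnt := @count_primepow R N (N %/ r) (U.+1 ^ 3).-1 _ (leq_div _ _) _.
have {cnt} : \sum_(1 <= c < (N %/ r).+1 | ~~ prime c && (mangoldt R c != 0)) 1 <= 16 * (U ^ 3)%:R * L :> R.
  apply: le_trans (cnt _ _) _; first exact: leq_trans N4.
    by rewrite prednK ?expn_gt0 // -expnM.
  have -> : 16 * (U ^ 3)%:R * L = (8 * (U ^ 3))%:R * (2 * L) by rewrite natrM; ring.
  rewrite ler_wpM2r ?mulr_ge0 // ler_nat.
  apply: leq_trans (leq_pred _) _; rewrite (_ : 8 = 2 ^ 3)%N // -expnMn leq_exp2r //.
  by rewrite mul2n -addnn -addn1 leq_add2l.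
apply: le_trans.
pose pp c := ~~ prime c && (mangoldt R c != 0).
apply: (@le_trans _ _ (\sum_(V.+1 <= c < (N %/ r).+1 | pp c) 1)); last first.
  rewrite [X in _ <= X](@big_cat_nat _ _ _ V.+1) //=; last by rewrite ltnS VN.
  by rewrite lerDr sumr_ge0.
rewrite [X in _ <= X]big_mkcond [X in X <= _]big_nat_cond [X in _ <= X]big_nat_cond.
rewrite [X in _ <= X]/= /pp.
apply: ler_sum => c /andP[/andP[Vc _] _].
have c1 : (1 < c)%N by apply: leq_ltn_trans Vc.
set z : R[i] := e (alpha * r%:R * c%:R).
have -> : (prime c)%:R%:C * z - (mangoldt R c)%:C * ((ln c%:R)^-1%:C * z) =
    ((prime c)%:R - mangoldt R c / ln c%:R)%:C * z.
  by rewrite rmorphB rmorphM /=; ring.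
rewrite normcM normc_e mulr1 normc_real.
have lc : ln c%:R != 0 :> R by rewrite gt_eqF // ln_gt0 // ltr1n.
case: (boolP (prime c)) => pc /=.
  by rewrite mangoldt_prime // mulfV // subrr normr0.
have [->|h] /= := eqVneq (mangoldt R c) 0; first by rewrite mul0r subr0 normr0.
have /andP[h1 h2] := mangoldt_ln_le1 c1 (leqnn c).
by rewrite sub0r normrN ger0_norm.
Qed.

Lemma small_primes :
  normc (\sum_(1 <= r < U.+1 | prime r)
   \sum_(1 <= c < N.+1 | prime c && (r * c <= N)%N) e (alpha * (r * c)%:R)) <=
  2881 * L ^+ 4 * W.
Proof.
have W0 : 0 <= W by apply: sqrtr_ge0.
set S := \sum_(_ <= _ < _ | _) _.
have h0 := small_mangoldt; set T := \sum_(_ <= _ < _ | _) _ in h0.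
have -> : S = (S - T) + T by rewrite subrK.
apply: le_trans (le_normcD _ _) _.
have h1 : normc (S - T) <= U%:R * (V%:R + 16 * (U ^ 3)%:R * L).
  rewrite /S /T -sumrB; apply: le_trans (le_normc_sum _ _ _) _.
  apply: (@le_trans _ _ (\sum_(1 <= r < U.+1) (V%:R + 16 * (U ^ 3)%:R * L))).
    rewrite [X in _ <= X](bigID prime) /= -[X in X <= _]addr0 lerD //; last first.
      by apply: sumr_ge0 => r _; rewrite addr_ge0 // !mulr_ge0.
    rewrite big_nat_cond [X in _ <= X]big_nat_cond.
    apply: ler_sum => r /andP[/andP[r0 rU] _].
    by apply: prime_mangoldt_diff; rewrite r0 -ltnS.
  by rewrite sumr_const_nat subn1 /= -[X in X <= _]mulr_natl.
have h2 : U%:R * (V%:R + 16 * (U ^ 3)%:R * L) = (U ^ 3)%:R + 16 * (L * (U ^ 4)%:R) :> R.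
  by rewrite /V !natrX natrM; ring.
have h3 := @U_le_W 3 isT; have h4 := @U_le_W 4 isT.
have h5 : 1 <= L ^+ 4 by rewrite exprn_ege1.
have h6 : L <= L ^+ 4 by rewrite ler_eXnr.
have h7 : W <= L ^+ 4 * W by rewrite ler_peMl.
have h8 : L * (U ^ 4)%:R <= L ^+ 4 * W by rewrite ler_pM.
have -> : 2881 * L ^+ 4 * W = 2881 * (L ^+ 4 * W) by ring.
have h9 : 2864 * L ^+ 4 * W = 2864 * (L ^+ 4 * W) by ring.
rewrite h9 in h0; rewrite h2 in h1.
by lra.
Qed.

(** The bilinear estimate with the single value [r = 1] and the indicator
    functions of the primes as coefficients. *)
Lemma large_primes :
  normc (\sum_(U.+1 <= m < N.+1 | prime m)
   \sum_(U.+1 <= c < N.+1 | prime c && (m * c <= N)%N) e (alpha * (m * c)%:R)) <=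
  48 * L ^+ 4 * W.
Proof.
have W0 : 0 <= W by apply: sqrtr_ge0.
have g01' (c m : nat) : (U < c)%N -> (U < m)%N -> 0 <= ((prime c)%:R : R) <= 1.
  by case: (prime c); rewrite ?mulr1n ?mulr0n ?lexx ?ler01.
have gd (c m : nat) : (U < c)%N -> (U < m)%N -> (prime c)%:R <= (prime c)%:R :> R by [].
have mult1 j : (0 < j <= N)%N -> \sum_(1 <= r < 2 | pred1 1%N r && (r %| j)%N) 1 <= 1 :> R.
  by move=> _; rewrite big_mkcond big_nat1 /= dvd1n.
have Q1 : 0 < 2 * L by have := L1; lra.
have hQ : \sum_(1 <= r < 2 | pred1 1%N r) \sum_(U.+1 <= m < N.+1)
    (prime m)%:R ^+ 2 / (r * m)%:R <= 2 * L.
  rewrite big_mkcond big_nat1 /=.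
  apply: le_trans (harm_le_ln R N4 (leqnn N)); rewrite /harm.
  rewrite [X in _ <= X](@big_cat_nat _ _ _ U.+1) //=; last by rewrite ltnS -[U]expn1 powU.
  rewrite -[X in X <= _]add0r lerD //; first by apply: sumr_ge0 => m _; rewrite invr_ge0.
  apply: ler_sum => m _; rewrite mul1n; case: (prime m); rewrite ?expr1n ?mul1r //.
  by rewrite expr0n mul0r invr_ge0.
have := typeII_bound (alpha := alpha) (N := N) (U := 1%N) (P := pred1 1%N)
  (g := fun c _ => (prime c)%:R) (A := fun m => (prime m)%:R) isT U0
  g01' gd q0 aq approx N4 qN U0 mult1 (lexx 1) Q1 hQ.
rewrite -/L => h.
have -> : \sum_(U.+1 <= m < N.+1 | prime m)
   \sum_(U.+1 <= c < N.+1 | prime c && (m * c <= N)%N) e (alpha * (m * c)%:R) =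
   \sum_(1 <= r < 2 | pred1 1%N r) \sum_(U.+1 <= m < N.+1) ((prime m)%:R)%:C *
    \sum_(U.+1 <= c < N.+1 | (r * m * c <= N)%N) ((prime c)%:R)%:C * e (alpha * (r * m * c)%:R) :> R[i].
  rewrite [RHS]big_mkcond big_nat1 /= big_mkcond; apply: eq_bigr => m _.
  case: (prime m) => /=; last by rewrite mul0r.
  rewrite mul1r big_mkcond [RHS]big_mkcond; apply: eq_bigr => c _.
  rewrite mul1n; case: (prime c) => /=; first by rewrite mul1r.
  by rewrite mul0r if_same.
apply: le_W_mul; first by rewrite mulr_ge0 ?ler0n ?exprn_ge0 ?L0.
apply: le_trans h _; rewrite div1r; set E := _ + q%:R + _.
have -> : 2 * L * (1152 * 1 * L ^+ 2 * N%:R * E) = 2304 * (L ^+ 3 * (N%:R * E)) by ring.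
have -> : (48 * L ^+ 4) ^+ 2 * (N%:R * E) = 2304 * (L ^+ 8 * (N%:R * E)) by ring.
have h1 : L ^+ 3 <= L ^+ 8 by rewrite ler_weXn2l.
have h2 : 0 <= N%:R * E by [].
by have h3 := ler_wpM2r h2 h1; lra.
Qed.

(** Split the pairs according to which of their members are at most [U]. By
    symmetry, those with only the second member small contribute the sum over
    the pairs with small first member, minus the at most [U ^ 2] terms with
    both members small. *)
Lemma prime_pairs_bound :
  normc (\sum_(1 <= r < N.+1 | prime r)
   \sum_(1 <= c < N.+1 | prime c && (r * c <= N)%N) e (alpha * (r * c)%:R)) <=
  (2 * 2881 + 49) * L ^+ 4 * W.
Proof.
have W0 : 0 <= W by apply: sqrtr_ge0.
pose F r c := if [&& prime r, prime c & (r * c <= N)%N] then e (alpha * (r * c)%:R) else 0 : R[i].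
have FC r c : F r c = F c r.
  by rewrite /F mulnC; case: (prime r); case: (prime c).
have toF s t t' : \sum_(s <= r < t | prime r) \sum_(s <= c < t' | prime c && (r * c <= N)%N)
    e (alpha * (r * c)%:R) = \sum_(s <= r < t) \sum_(s <= c < t') F r c.
  rewrite big_mkcond; apply: eq_bigr => r _; rewrite /F.
  case: (prime r) => /=; last by rewrite big1.
  by rewrite big_mkcond.
have h1 := small_primes; rewrite toF in h1.
have h2 := large_primes; rewrite toF in h2.
rewrite toF.
have UN1 : (U.+1 <= N.+1)%N by rewrite ltnS -[U]expn1 powU.
have -> : \sum_(1 <= r < N.+1) \sum_(1 <= c < N.+1) F r c =
  \sum_(1 <= r < U.+1) \sum_(1 <= c < N.+1) F r c +
  (\sum_(1 <= r < U.+1) \sum_(1 <= c < N.+1) F r c - \sum_(1 <= r < U.+1) \sum_(1 <= c < U.+1) F r c) +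
  \sum_(U.+1 <= r < N.+1) \sum_(U.+1 <= c < N.+1) F r c.
  rewrite [LHS](@big_cat_nat _ _ _ U.+1) //= -addrA; congr (_ + _).
  have -> : \sum_(U.+1 <= r < N.+1) \sum_(1 <= c < N.+1) F r c =
     \sum_(U.+1 <= r < N.+1) \sum_(1 <= c < U.+1) F r c +
     \sum_(U.+1 <= r < N.+1) \sum_(U.+1 <= c < N.+1) F r c.
    by rewrite -big_split /=; apply: eq_bigr => r _; rewrite (@big_cat_nat _ _ _ U.+1).
  congr (_ + _); rewrite exchange_big /= -sumrB; apply: eq_bigr => r _.
  rewrite [X in _ = X - _](@big_cat_nat _ _ _ U.+1) //= addrAC subrr add0r.
  by apply: eq_bigr => c _; rewrite FC.
have h3 : normc (\sum_(1 <= r < U.+1) \sum_(1 <= c < U.+1) F r c) <= W.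
  apply: le_trans (@U_le_W 2 isT).
  apply: le_trans (le_normc_sum _ _ _) _.
  apply: (@le_trans _ _ (\sum_(1 <= r < U.+1) \sum_(1 <= c < U.+1) 1)).
    apply: ler_sum => r _; apply: le_trans (le_normc_sum _ _ _) _.
    apply: ler_sum => c _; rewrite /F; case: ifP => _; rewrite ?normc_e //.
    by rewrite normc0.
  by rewrite !sumr_const_nat !subn1 /= -mulrnA.
set A := \sum_(1 <= r < U.+1) _ in h1 *; set B := \sum_(U.+1 <= r < N.+1) _ in h2 *.
set D := \sum_(1 <= r < U.+1) _ in h3 *.
have h4 : normc (A + (A - D) + B) <= normc A + (normc A + normc D) + normc B.
  apply: le_trans (le_normcD _ _) _; rewrite lerD2r.
  apply: le_trans (le_normcD _ _) _; rewrite lerD2l.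
  by apply: le_trans (le_normcD _ _) _; rewrite normcN.
apply: le_trans h4 _.
have h5 : 1 <= L ^+ 4 by rewrite exprn_ege1.
have h7 : W <= L ^+ 4 * W by rewrite ler_peMl.
rewrite -!mulrA in h1 h2 *.
by lra.
Qed.

End PrimePairs.

(** * Trading logarithms against powers *)

Section Endgame.
Variable R : realType.

Lemma S2_truncn (alpha X : R) : 0 <= X ->
  S2 alpha X = \sum_(1 <= r < (Num.truncn X).+1 | prime r)
   \sum_(1 <= c < (Num.truncn X).+1 | prime c && (r * c <= Num.truncn X)%N) e (alpha * (r * c)%:R).
Proof.
move=> X0; rewrite /S2 big_ltn_cond //=; apply: eq_bigr => r _.
by rewrite big_ltn_cond //=; apply: eq_bigl => c; rewrite truncn_ge_nat.
Qed.

Lemma S2_eq0 (alpha X : R) : 0 <= X -> (Num.truncn X < 4)%N -> S2 alpha X = 0.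
Proof.
move=> X0 N4; rewrite S2_truncn // big1 // => r pr; rewrite big1 // => c /andP[pc h].
have := prime_gt1 pr; have := prime_gt1 pc.
by move: h N4; clear; nia.
Qed.

(** Forget that the members are prime, and sum [N / r] over [r]. *)
Lemma S2_trivial (alpha X : R) : 0 <= X -> (4 <= Num.truncn X)%N ->
  normc (S2 alpha X) <= 2 * X * ln X.
Proof.
move=> X0 N4; set N := Num.truncn X in N4 *.
have NX : N%:R <= X by rewrite truncn_le.
have N0 : 0 < N%:R :> R by rewrite ltr0n (leq_trans _ N4).
have lX : ln N%:R <= ln X by rewrite ler_ln ?posrE // (lt_le_trans N0).
have L1 := ln_nat_ge1 R N4.
apply: (@le_trans _ _ (N%:R * harm R N)); last first.
  have h := harm_le_ln R N4 (leqnn N); have h0 := harm_ge0 R N.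
  apply: le_trans (ler_wpM2l (ltW N0) h) _.
  by have := ler_pM (ltW N0) (le_trans ler01 L1) NX lX; lra.
rewrite S2_truncn // -/N; apply: le_trans (le_normc_sum _ _ _) _.
apply: (@le_trans _ _ (\sum_(1 <= r < N.+1 | prime r) N%:R / r%:R)); last first.
  by rewrite /harm mulr_sumr [X in _ <= X](bigID prime) /= lerDl sumr_ge0.
rewrite big_nat_cond [X in _ <= X]big_nat_cond.
apply: ler_sum => r /andP[/andP[r0 _] _].
apply: le_trans (le_normc_sum _ _ _) _.
apply: (@le_trans _ _ (\sum_(1 <= c < N.+1 | (r * c <= N)%N) 1)).
  apply: (@le_trans _ _ (\sum_(1 <= c < N.+1 | prime c && (r * c <= N)%N) 1)).
    by apply: ler_sum => c _; rewrite normc_e.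
  rewrite [X in _ <= X](bigID prime) /= (eq_bigl (fun c => (r * c <= N)%N && prime c)).
    by rewrite lerDl sumr_ge0.
  by move=> c; rewrite andbC.
by rewrite sum_le_div // sumr_const_nat subn1 ratio_le.
Qed.

Lemma nat_root6 N : (0 < N)%N -> exists U, [/\ (0 < U)%N, (U ^ 6 <= N)%N & (N < U.+1 ^ 6)%N].
Proof.
move=> N0.
have ex : exists n, (n ^ 6 <= N)%N by exists 0%N.
have bd n : (n ^ 6 <= N)%N -> (n <= N)%N.
  by apply: leq_trans; rewrite -{1}(expn1 n); case: n => // n; rewrite leq_pexp2l.
case: (ex_maxnP ex bd) => U h1 h2; exists U; split=> //.
  by apply: h2; rewrite exp1n.
by rewrite ltnNge; apply/negP => /h2; rewrite ltnn.
Qed.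

Lemma powR_root (x p : R) n : 0 <= x -> p * n%:R = 1 -> (x `^ p) ^+ n = x.
Proof. by move=> x0 pn; rewrite -powR_mulrn ?powR_ge0 // -powRrM pn powRr1. Qed.

Lemma powR_pow (x p : R) n k : 0 <= x -> p * n%:R = k%:R -> (x `^ p) ^+ n = x ^+ k.
Proof. by move=> x0 pn; rewrite -powR_mulrn ?powR_ge0 // -powRrM pn powR_mulrn. Qed.

Lemma ln_le_powR (x p : R) : 1 <= x -> 0 < p -> ln x <= p^-1 * x `^ p.
Proof.
move=> x1 p0; have x0 : 0 < x by apply: lt_le_trans x1.
have := ln_sublinear (powR_gt0 p x0); rewrite ln_powR => h.
by rewrite ler_pdivlMl // ltW.
Qed.

Section Interpolation.
Variables (S X C l u : R) (q : nat).
Hypotheses (S0 : 0 <= S) (X1 : 1 <= X) (C1 : 1 <= C) (l1 : 1 <= l) (q0 : (0 < q)%N).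
Hypothesis trivial : S <= 2 * X * l.

Let X0 : 0 < X. Proof. exact: lt_le_trans X1. Qed.
Let l0 : 0 < l. Proof. exact: lt_le_trans l1. Qed.
Let Q0 : 0 < q%:R :> R. Proof. by rewrite ltr0n. Qed.
Let C0 : 0 < C. Proof. exact: lt_le_trans C1. Qed.

(** Compare sixth powers, after writing [S ^ 6 = S ^ 2 * S ^ 4] and using the
    trivial bound for the second factor: the exponent of [q] drops from [1/2]
    to [1/6], and that of [l] from [4] to [2]. *)
Lemma interpolate_q : S ^+ 2 <= 3 * (C * l ^+ 4) ^+ 2 * (X * (X / q%:R)) ->
  S <= 48 * C * (X / q%:R `^ (1 / 6) * l `^ (7 / 3)).
Proof.
move=> h.
set Y := _ * l `^ _.
have Y0 : 0 <= Y by rewrite !mulr_ge0 ?invr_ge0 ?powR_ge0 // ltW.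
have e1 : Y ^+ 6 = X ^+ 6 / q%:R * l ^+ 14.
  by rewrite /Y !exprMn exprVn powR_root ?(@powR_pow l (7 / 3) 6 14) ?ltW //; field.
have h1 : S ^+ 4 <= (2 * X * l) ^+ 4 by rewrite lerXn2r ?nnegrE // (le_trans S0).
have h2 := ler_pM (exprn_ge0 2 S0) (exprn_ge0 4 S0) h h1.
have K0 : 0 <= 48 * C * Y by apply: mulr_ge0 Y0; rewrite mulr_ge0 ?ler0n ?(ltW C0).
rewrite -(@ler_pXn2r _ 6) ?nnegrE //.
have -> : S ^+ 6 = S ^+ 2 * S ^+ 4 by ring.
apply: le_trans h2 _; rewrite [X in _ <= X]exprMn e1.
set z := X ^+ 6 / q%:R * l ^+ 12.
have z0 : 0 <= z by rewrite !mulr_ge0 ?invr_ge0 ?exprn_ge0 // ltW.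
have -> : 3 * (C * l ^+ 4) ^+ 2 * (X * (X / q%:R)) * (2 * X * l) ^+ 4 = 48 * C ^+ 2 * z.
  by rewrite /z; ring.
have -> : (48 * C) ^+ 6 * (X ^+ 6 / q%:R * l ^+ 14) = (48 * C) ^+ 6 * l ^+ 2 * z.
  by rewrite /z; ring.
rewrite ler_wpM2r //.
have h3 : 48 * C ^+ 2 <= (48 * C) ^+ 2 by rewrite exprMn ler_wpM2r ?exprn_ge0 ?ltW //; lra.
have h4 : (48 * C) ^+ 2 <= (48 * C) ^+ 6 by rewrite ler_weXn2l //; have := C1; lra.
have h5 : 1 <= l ^+ 2 by rewrite exprn_ege1.
have h6 : 0 <= (48 * C) ^+ 6 by rewrite exprn_ge0 ?mulr_ge0 ?ler0n ?(ltW C0).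
apply: le_trans (le_trans h3 h4) _.
by rewrite ler_peMr.
Qed.

(** As in [interpolate_q], with [S ^ 8 = S ^ 2 * S ^ 6]. *)
Lemma interpolate_qX : S ^+ 2 <= 3 * (C * l ^+ 4) ^+ 2 * (X * q%:R) ->
  S <= 192 * C * (X `^ (7 / 8) * q%:R `^ (1 / 8) * l `^ (9 / 4)).
Proof.
move=> h.
set Y := _ * l `^ _.
have Y0 : 0 <= Y by rewrite !mulr_ge0 ?powR_ge0.
have e1 : Y ^+ 8 = X ^+ 7 * q%:R * l ^+ 18.
  rewrite /Y !exprMn [(q%:R `^ _) ^+ 8]powR_root ?ltW //; last by field.
  by rewrite (@powR_pow X (7 / 8) 8 7) ?(@powR_pow l (9 / 4) 8 18) ?ltW //; field.
have h1 : S ^+ 6 <= (2 * X * l) ^+ 6 by rewrite lerXn2r ?nnegrE // (le_trans S0).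
have h2 := ler_pM (exprn_ge0 2 S0) (exprn_ge0 6 S0) h h1.
have K0 : 0 <= 192 * C * Y by apply: mulr_ge0 Y0; rewrite mulr_ge0 ?ler0n ?(ltW C0).
rewrite -(@ler_pXn2r _ 8) ?nnegrE //.
have -> : S ^+ 8 = S ^+ 2 * S ^+ 6 by ring.
apply: le_trans h2 _; rewrite [X in _ <= X]exprMn e1.
set z := X ^+ 7 * q%:R * l ^+ 14.
have z0 : 0 <= z by rewrite !mulr_ge0 ?exprn_ge0 // ltW.
have -> : 3 * (C * l ^+ 4) ^+ 2 * (X * q%:R) * (2 * X * l) ^+ 6 = 192 * C ^+ 2 * z.
  by rewrite /z; ring.
have -> : (192 * C) ^+ 8 * (X ^+ 7 * q%:R * l ^+ 18) = (192 * C) ^+ 8 * l ^+ 4 * z.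
  by rewrite /z; ring.
rewrite ler_wpM2r //.
have h3 : 192 * C ^+ 2 <= (192 * C) ^+ 2 by rewrite exprMn ler_wpM2r ?exprn_ge0 ?ltW //; lra.
have h4 : (192 * C) ^+ 2 <= (192 * C) ^+ 8 by rewrite ler_weXn2l //; have := C1; lra.
have h5 : 1 <= l ^+ 4 by rewrite exprn_ege1.
have h6 : 0 <= (192 * C) ^+ 8 by rewrite exprn_ge0 ?mulr_ge0 ?ler0n ?(ltW C0).
apply: le_trans (le_trans h3 h4) _.
by rewrite ler_peMr.
Qed.

Variable b : R.
Hypotheses (b0 : 0 < b) (lb : l <= b * X `^ (5 / 102 / 8)).
Hypotheses (u0 : 0 < u) (Xu : X <= (2 * u) ^+ 6).

(** The bound [S ^ 2 = O (l ^ 8 * X ^ (11/6))] saves a larger power of [X] than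
    [1/17] in [S]; the difference [5/102] of the exponents of [X] in [S ^ 2]
    absorbs [l ^ 8]. *)
Lemma interpolate_X : S ^+ 2 <= 3 * (C * l ^+ 4) ^+ 2 * (X * (X / u)) ->
  S <= 6 * C * b ^+ 4 * (X `^ (16 / 17) * l `^ (39 / 17)).
Proof.
move=> h; set D : R := b ^+ 4.
have D0 : 0 <= D by rewrite exprn_ge0 // ltW.
have xu : X `^ (1 / 6) <= 2 * u.
  rewrite -(@ler_pXn2r _ 6) ?nnegrE ?powR_ge0 //; last by rewrite mulr_ge0 // ltW.
  by rewrite powR_root ?(ltW X0) //; field.
have x6 : 0 < X `^ (1 / 6) by rewrite powR_gt0.
have iu : u^-1 <= 2 / X `^ (1 / 6).
  by rewrite ler_pdivlMr // mulrC ler_pdivrMr.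
have e1 : X * X / X `^ (1 / 6) = X `^ (11 / 6).
  have -> : 11 / 6 = 2%:R - 1 / 6 :> R by field.
  rewrite powRB; last by rewrite (gt_eqF X0) implybT.
  by rewrite powR_mulrn ?ltW // expr2.
have hl : l ^+ 8 <= D ^+ 2 * X `^ (5 / 102).
  have h2 : l ^+ 8 <= (b * X `^ (5 / 102 / 8)) ^+ 8.
    by rewrite lerXn2r ?nnegrE ?(ltW l0) // mulr_ge0 ?powR_ge0 // ltW.
  apply: le_trans h2 _; rewrite exprMn /D -exprM -[(X `^ _) ^+ 8]powR_mulrn ?powR_ge0 // -powRrM.
  by rewrite (_ : 5 / 102 / 8 * 8%:R = 5 / 102) //; field.
set Y := _ * l `^ _.
have Y0 : 0 <= Y by rewrite !mulr_ge0 ?powR_ge0.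
have YX : X `^ (32 / 17) <= Y ^+ 2.
  rewrite /Y exprMn -[(X `^ _) ^+ 2]powR_mulrn ?powR_ge0 // -powRrM.
  rewrite (_ : 16 / 17 * 2%:R = 32 / 17); last by field.
  rewrite ler_peMr ?powR_ge0 // exprn_ege1 //.
  have p0 : 0 <= 39 / 17 :> R by lra.
  by rewrite -[X in X <= _](powRr0 l) (ler_powR l1 p0).
have K0 : 0 <= 6 * C * D * Y.
  by apply: mulr_ge0 Y0; rewrite mulr_ge0 // mulr_ge0 ?ler0n ?(ltW C0).
rewrite -(@ler_pXn2r _ 2) ?nnegrE //.
have h3 : X * (X / u) <= 2 * X `^ (11 / 6).
  rewrite mulrA -e1; have -> : 2 * (X * X / X `^ (1 / 6)) = X * X * (2 / X `^ (1 / 6)) by ring.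
  by rewrite ler_wpM2l // mulr_ge0 // ltW.
have h4 : S ^+ 2 <= 6 * C ^+ 2 * (l ^+ 8 * X `^ (11 / 6)).
  apply: le_trans h _.
  have -> : 6 * C ^+ 2 * (l ^+ 8 * X `^ (11 / 6)) = 3 * (C * l ^+ 4) ^+ 2 * (2 * X `^ (11 / 6)).
    by ring.
  by rewrite ler_wpM2l // mulr_ge0 // exprn_ge0 // mulr_ge0 ?exprn_ge0 ?ltW.
have h5 : l ^+ 8 * X `^ (11 / 6) <= D ^+ 2 * Y ^+ 2.
  apply: (@le_trans _ _ (D ^+ 2 * X `^ (5 / 102) * X `^ (11 / 6))).
    by rewrite ler_wpM2r ?powR_ge0.
  have e2 : X `^ (5 / 102) * X `^ (11 / 6) = X `^ (32 / 17).
    rewrite -powRD; last by rewrite (gt_eqF X0) implybT.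
    by congr (_ `^ _); field.
  by rewrite -[D ^+ 2 * _ * _]mulrA e2; apply: ler_wpM2l => //; apply: exprn_ge0.
apply: le_trans h4 _.
have -> : (6 * C * D * Y) ^+ 2 = 36 * C ^+ 2 * (D ^+ 2 * Y ^+ 2) by ring.
have h6 : 0 <= C ^+ 2 by rewrite sqr_ge0.
have h7 : 0 <= D ^+ 2 * Y ^+ 2 by rewrite mulr_ge0 ?sqr_ge0.
have h8 := ler_wpM2l h6 h5; have h9 := mulr_ge0 h6 h7.
by rewrite -!mulrA in h8 h9 *; lra.
Qed.

End Interpolation.

End Endgame.

Theorem theorem5p1 (R : realType) :
  exists K : R, forall (alpha X : R) (a : int) (q : nat),
    1 <= X ->
    (0 < q)%N ->
    coprimez a q%:Z ->
    `|alpha - a%:~R / q%:R| <= 1 / q%:R ^+ 2 ->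
    `|S2 alpha X| <=
      (K * (X / q%:R `^ (1 / 6) * ln X `^ (7 / 3)
            + X `^ (16 / 17) * ln X `^ (39 / 17)
            + X `^ (7 / 8) * q%:R `^ (1 / 8) * ln X `^ (9 / 4)))%:C.
Proof.
have [C [C1 hC]] : exists C : R, 1 <= C /\ forall (alpha : R) a q N U,
    (0 < q)%N -> coprimez a q%:Z -> `|alpha - a%:~R / q%:R| <= 1 / q%:R ^+ 2 ->
    (4 <= N)%N -> (q <= N)%N -> (0 < U)%N -> (U ^ 6 <= N)%N -> (N < U.+1 ^ 6)%N ->
    normc (\sum_(1 <= r < N.+1 | prime r)
      \sum_(1 <= c < N.+1 | prime c && (r * c <= N)%N) e (alpha * (r * c)%:R)) <=
    C * ln N%:R ^+ 4 * Num.sqrt (N%:R * (N%:R / q%:R + q%:R + N%:R / U%:R)).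
  exists (2 * 2881 + 49); split; first by lra.
  by move=> *; apply: prime_pairs_bound; eassumption.
have [b [b1 hb]] : exists b : R, 1 <= b /\
    forall X : R, 1 <= X -> ln X <= b * X `^ (5 / 102 / 8).
  exists (5 / 102 / 8)^-1; split; first by lra.
  by move=> X X1; apply: ln_le_powR => //; lra.
have b0 : 0 < b by apply: lt_le_trans b1.
pose D : R := b ^+ 4.
have D1 : 1 <= D by rewrite exprn_ege1.
exists (192 * C * D) => alpha X a q X1 q0 aq approx.
have X0 : 0 < X by apply: lt_le_trans X1.
have C0 : 0 < C by apply: lt_le_trans C1.
have l0 : 0 <= ln X by apply: ln_ge0.
rewrite norm_normc lecR.
set Y1 := X / _ * _; set Y2 := X `^ (16 / 17) * _; set Y3 := X `^ (7 / 8) * _ * _.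
have Y10 : 0 <= Y1 by rewrite !mulr_ge0 ?invr_ge0 ?powR_ge0 // ltW.
have Y20 : 0 <= Y2 by rewrite !mulr_ge0 ?powR_ge0.
have Y30 : 0 <= Y3 by rewrite !mulr_ge0 ?powR_ge0.
have CD : C <= C * D by rewrite ler_peMr // ltW.
have final y c : 0 <= y -> y <= Y1 + Y2 + Y3 -> c <= 192 * C * D ->
    normc (S2 alpha X) <= c * y -> normc (S2 alpha X) <= 192 * C * D * (Y1 + Y2 + Y3).
  move=> y0 yY cK h; apply: le_trans h _; apply: le_trans (ler_wpM2r y0 cK) _.
  by rewrite ler_wpM2l // !mulr_ge0 // ?(ltW C0) // (le_trans ler01).
have [N4|N4] := ltnP (Num.truncn X) 4.
  by rewrite S2_eq0 ?(ltW X0) // normc0 !mulr_ge0 ?addr_ge0 // ?(ltW C0) // (le_trans ler01).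
have triv := S2_trivial alpha (ltW X0) N4.
set N := Num.truncn X in N4.
have NX : N%:R <= X by rewrite truncn_le ltW.
have N0 : 0 < N%:R :> R by rewrite ltr0n (leq_trans _ N4).
have lNX : ln N%:R <= ln X by rewrite ler_ln ?posrE.
have L1 := ln_nat_ge1 R N4.
have l1 := le_trans L1 lNX.
(* For [q > X] the third term exceeds the trivial bound. *)
have [Nq|qN] := ltnP N q.
  apply: (@final Y3 2) => //; first by lra.
    by have := C1; lra.
  rewrite -mulrA in triv; apply: le_trans triv _; rewrite ler_wpM2l // /Y3.
  have Xq : X <= q%:R.
    by rewrite ltW // (lt_le_trans (truncnS_gt X)) // ler_nat.
  apply: ler_pM => //; first exact: ltW.
    have {1}-> : X = X `^ (7 / 8) * X `^ (1 / 8).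
      rewrite -powRD; last by rewrite (gt_eqF X0) implybT.
      by rewrite (_ : 7 / 8 + 1 / 8 = 1) ?powRr1 ?ltW //; field.
    rewrite ler_wpM2l ?powR_ge0 // ge0_ler_powR ?nnegrE ?divr_ge0 // ltW //.
  rewrite -{1}[ln X]powRr1 //; apply: ler_powR => //.
  by lra.
have [|U [U0 UN NU]] := @nat_root6 N; first by apply: leq_trans N4.
have u0 : 0 < U%:R :> R by rewrite ltr0n.
have Xu : X <= (2 * U%:R) ^+ 6.
  apply: (@le_trans _ _ N.+1%:R); first by rewrite ltW // truncnS_gt.
  rewrite -natrM -natrX ler_nat; apply: leq_trans NU _.
  by rewrite leq_exp2r // mul2n -addnn -addn1 leq_add2l.
have := hC alpha a q N U q0 aq approx N4 qN U0 UN NU.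
rewrite -S2_truncn ?(ltW X0) //; set W := Num.sqrt _ => hS.
have Q0 : 0 < q%:R :> R by rewrite ltr0n.
set E1 := X * (X / q%:R); set E2 := X * q%:R; set E3 := X * (X / U%:R).
have W2 : W ^+ 2 <= E1 + E2 + E3.
  rewrite sqr_sqrtr; last by rewrite mulr_ge0 // !addr_ge0 // divr_ge0.
  rewrite /E1 /E2 /E3 -!mulrDr; apply: ler_pM => //.
  by rewrite !lerD // ler_wpM2r ?invr_ge0 ?(ltW Q0) ?(ltW u0).
have S0 := normc_ge0 (S2 alpha X).
have sq : normc (S2 alpha X) ^+ 2 <= (C * ln X ^+ 4) ^+ 2 * (E1 + E2 + E3).
  have W0 : 0 <= W by apply: sqrtr_ge0.
  have h : normc (S2 alpha X) <= C * ln X ^+ 4 * W.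
    apply: le_trans hS _; rewrite ler_wpM2r // ler_wpM2l ?(ltW C0) //.
    by rewrite lerXn2r ?nnegrE // (le_trans ler01).
  have h2 : normc (S2 alpha X) ^+ 2 <= (C * ln X ^+ 4 * W) ^+ 2.
    by rewrite lerXn2r ?nnegrE // (le_trans S0).
  by apply: le_trans h2 _; rewrite exprMn ler_wpM2l // sqr_ge0.
set P := (C * _) ^+ 2 in sq.
have P0 : 0 <= P by apply: sqr_ge0.
have pick E : E1 + E2 + E3 <= 3 * E -> normc (S2 alpha X) ^+ 2 <= 3 * P * E.
  move=> hE; apply: le_trans sq _; have := ler_wpM2l P0 hE; lra.
have cK1 : 48 * C <= 192 * C * D by have := C1; lra.
have cK3 : 192 * C <= 192 * C * D by lra.
have cK2 : 6 * C * D <= 192 * C * D by have := CD; have := C1; lra.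
(* The largest of the three terms decides which interpolation applies. *)
have [h12|h12] := lerP E1 E2.
  have [h23|h23] := lerP E2 E3.
    apply: (final Y2 _ Y20 _ cK2); first by lra.
    apply: (interpolate_X (l := ln X) (u := U%:R)) => //; first exact: hb.
    by apply: (pick E3); lra.
  apply: (final Y3 _ Y30 _ cK3); first by lra.
  by apply: (interpolate_qX (l := ln X)) => //; apply: (pick E2); lra.
have [h13|h13] := lerP E1 E3.
  apply: (final Y2 _ Y20 _ cK2); first by lra.
  apply: (interpolate_X (l := ln X) (u := U%:R)) => //; first exact: hb.
  by apply: (pick E3); lra.
apply: (final Y1 _ Y10 _ cK1); first by lra.
by apply: (interpolate_q (l := ln X)) => //; apply: (pick E1); lra.
Qed.
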